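(* For $\mathcal S=\{(1,0),(1,-1),(-2,1),(-2,0)\}$, the generating function of quadrant walks with steps in $\mathcal S$ is $$Q(x,y)=[x^{\ge}y^{\ge}]\frac{(2-y)(x^3-y^2)(x^6y-3x^3y-x^3-y^2)(x^3-2y)}{x^9y^4\left(1-t(\bar x^2+\bar x^2y+x\bar y+x)\right)},$$ where the right-hand side is seen as a power series in $t$ with coefficients in $\mathbb Q[x,\bar x,y,\bar y]$. The coefficients are hypergeometric: $q(i,j;n)$ is zero unless $n$ is of the form $n=i+3j+3m$ (with $m\in\mathbb N$), in which case $$q(i,j;n)=\frac{(i+1)(j+1)(i+3j+4)\big((i+2j+2)(i+2j+3)+m(2i+3j+4)\big)\,n!\,(n+3)!}{m!\,(m+j+1)!\,(2m+i+2j+3)!\,(2m+i+3j+4)!}.$$ The excursion exponent $\alpha_e$ and the walk exponent $\alpha_w$ are both $-5$.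
   Context: $\bar x=1/x$, $\bar y=1/y$, $\mathbb N=\{0,1,2,\ldots\}$. $Q(x,y)\equiv Q(x,y;t)=\sum_{i,j,n\ge0}q(i,j;n)x^iy^jt^n$, where $q(i,j;n)$ is the number of $n$-step walks with steps in $\mathcal S$ from $(0,0)$ to $(i,j)$ staying in $\mathbb N^2$. $[x^\ge y^\ge]$ keeps only the monomials $x^iy^jt^n$ with $i,j\ge0$. The excursion exponent $\alpha_e$ is the exponent of $n$ in the asymptotic behaviour of the number of quadrant excursions: with $p$ the period of the model (the gcd of the lengths of walks with steps in $\mathcal S$, not confined to the quadrant, from the origin to itself), there are $\mu>0$ and constants $\kappa_1,\kappa_2>0$ with $\kappa_1\mu^nn^{\alpha_e}\le q(0,0;n)\le\kappa_2\mu^nn^{\alpha_e}$ for all large $n$ divisible by $p$. The walk exponent $\alpha_w$ is the exponent of $n$ in the asymptotic behaviour of the total number $q_n=\sum_{i,j}q(i,j;n)$ of $n$-step quadrant walks: $q_n\sim C_n\rho^nn^{\alpha_w}$ for some $\rho>0$ and some positive sequence $C_n$ that is periodic in $n$. *)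

(* Defs.v *)
From HB Require Import structures.
From mathcomp Require Import all_boot all_order all_algebra finmap monalg.
From mathcomp Require Import all_classical all_reals all_analysis.

Set Implicit Arguments.
Unset Strict Implicit.
Unset Printing Implicit Defensive.

Import Order.TTheory GRing.Theory Num.Theory.
Import numFieldNormedType.Exports.

Local Open Scope classical_set_scope.
Local Open Scope ring_scope.

Definition lattice_point := (int * int)%type.

Definition position (S : {fset lattice_point}) (w : seq S) : lattice_point :=
  \sum_(s <- w) val s.

Definition in_quadrant (z : lattice_point) : bool := (0 <= z.1) && (0 <= z.2).

(* take k w ends at the point visited after k steps. *)
Definition stays_in_quadrant (S : {fset lattice_point}) (w : seq S) : bool :=
  all (fun k => in_quadrant (position (take k w))) (iota 0 (size w).+1).

Definition quadrant_walks (S : {fset lattice_point}) (i j n : nat) : nat :=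
  #|[pred w : n.-tuple S |
      stays_in_quadrant w && (position w == (i%:Z, j%:Z))]|.

Lemma finite_quadrant_walks (S : {fset lattice_point}) (n : nat) :
  finite_set [set ij : nat * nat | quadrant_walks S ij.1 ij.2 n != 0%N].
Proof.
pose f (w : n.-tuple S) := (`|(position w).1|%N, `|(position w).2|%N).
apply: (@sub_finite_set _ _ (f @` [set: n.-tuple S])); last first.
  exact/finite_image/finite_finset.
move=> [i j] /=; rewrite -lt0n => /card_gt0P[w].
by rewrite inE => /andP[_ /eqP Ew]; exists w; rewrite // /f Ew.
Qed.

(* Sums over [set: nat * nat] range over the support of the summand, which is
   finite here by finite_quadrant_walks. *)
Definition total_quadrant_walks (S : {fset lattice_point}) (n : nat) : nat :=
  (\sum_(ij \in [set: nat * nat]) quadrant_walks S ij.1 ij.2 n)%N.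

(* << c *g (i, j) >> is the monomial c x^i y^j.  The library's product on malg
   is unavailable: it requires a monoid of exponents without nontrivial units. *)
Definition laurent := {malg rat[lattice_point]}.

HB.instance Definition _ := Choice.on laurent.
HB.instance Definition _ := GRing.Lmodule.on laurent.

Section LaurentRing.
Implicit Types (f g h : laurent) (u v : lattice_point).

Definition laurent_one : laurent := << 1 *g (0 : lattice_point) >>.

Definition laurent_mul f g : laurent :=
  \sum_(u <- msupp f) \sum_(v <- msupp g) << f@_u * g@_v *g (u + v) >>.

Lemma laurent_mulw (d1 d2 : {fset lattice_point}) f g :
  (msupp f `<=` d1)%fset -> (msupp g `<=` d2)%fset ->
  laurent_mul f g =
    \sum_(u <- d1) \sum_(v <- d2) << f@_u * g@_v *g (u + v) >>.
Proof.
move=> le1 le2; rewrite /laurent_mul (big_fset_incl _ le1) /=.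
  apply/eq_bigr=> u _; apply/big_fset_incl => // v _ /mcoeff_outdom ->.
  by rewrite mulr0 monalgU0.
move=> u _ /mcoeff_outdom fu.
by rewrite big1 => // v _; rewrite fu mul0r monalgU0.
Qed.

Lemma laurent_mulC : commutative laurent_mul.
Proof.
move=> f g; rewrite /laurent_mul exchange_big; apply/eq_bigr=> v _.
by apply/eq_bigr=> u _; rewrite mulrC addrC.
Qed.

Lemma laurent_mul0 : left_zero (0 : laurent) laurent_mul.
Proof. by move=> g; rewrite /laurent_mul msupp0 big_seq_fset0. Qed.

Lemma laurent_mulDl : left_distributive laurent_mul +%R.
Proof.
move=> f g h.
rewrite [in RHS](laurent_mulw (fsubsetUl _ (msupp g)) (fsubset_refl _)).
rewrite [in RHS](laurent_mulw (fsubsetUr (msupp f) _) (fsubset_refl _)).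
rewrite (laurent_mulw (msuppD_le _ _) (fsubset_refl _)).
rewrite -big_split /=; apply/eq_bigr=> u _.
rewrite -big_split /=; apply/eq_bigr=> v _.
by rewrite mcoeffD mulrDl monalgUD.
Qed.

Lemma laurent_mulUU (c d : rat) u v :
  laurent_mul << c *g u >> << d *g v >> = << c * d *g (u + v) >>.
Proof.
by rewrite (laurent_mulw msuppU_le msuppU_le) !big_seq_fset1 !mcoeffUU.
Qed.

Lemma laurent_mulDr : right_distributive laurent_mul +%R.
Proof.
by move=> f g h; rewrite laurent_mulC laurent_mulDl !(laurent_mulC _ f).
Qed.

Lemma laurent_mulr0 : right_zero (0 : laurent) laurent_mul.
Proof. by move=> f; rewrite laurent_mulC laurent_mul0. Qed.

Lemma laurent_mul_suml (I : Type) (r : seq I) (F : I -> laurent) g :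
  laurent_mul (\sum_(i <- r) F i) g = \sum_(i <- r) laurent_mul (F i) g.
Proof.
exact: (big_morph (laurent_mul^~ g) (fun _ _ => laurent_mulDl _ _ _)
          (laurent_mul0 _)).
Qed.

Lemma laurent_mul_sumr (I : Type) (r : seq I) (F : I -> laurent) g :
  laurent_mul g (\sum_(i <- r) F i) = \sum_(i <- r) laurent_mul g (F i).
Proof.
exact: (big_morph (laurent_mul g) (fun _ _ => laurent_mulDr _ _ _)
          (laurent_mulr0 _)).
Qed.

Lemma laurent_mulA : associative laurent_mul.
Proof.
move=> f g h; rewrite [f]monalgE; set r := msupp f.
rewrite [laurent_mul _ g]laurent_mul_suml [LHS]laurent_mul_suml.
rewrite [RHS]laurent_mul_suml; apply/eq_bigr=> u _.
rewrite [g]monalgE [laurent_mul _ h in LHS]laurent_mul_suml.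
rewrite [LHS]laurent_mul_sumr [laurent_mul _ (\sum_(k <- _) _)]laurent_mul_sumr.
rewrite [RHS]laurent_mul_suml; apply/eq_bigr=> v _.
rewrite [h]monalgE [laurent_mul << g@_v *g v >> _]laurent_mul_sumr.
rewrite [LHS]laurent_mul_sumr [RHS]laurent_mul_sumr.
by apply/eq_bigr=> w _; rewrite !laurent_mulUU mulrA addrA.
Qed.

Lemma laurent_mul1 : left_id laurent_one laurent_mul.
Proof.
move=> g; rewrite [g]monalgE laurent_mul_sumr.
by apply/eq_bigr=> u _; rewrite laurent_mulUU mul1r add0r.
Qed.

Lemma laurent_one_neq0 : laurent_one != 0.
Proof. by rewrite monalgU_eq0 oner_eq0. Qed.

End LaurentRing.

HB.instance Definition _ := GRing.Zmodule_isComNzRing.Build laurent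
  laurent_mulA laurent_mulC laurent_mul1 laurent_mulDl laurent_one_neq0.

Definition lmonom (u : lattice_point) : laurent := << 1 *g u >>.

Definition lX : laurent := lmonom (1, 0).
Definition lXbar : laurent := lmonom (-1, 0).
Definition lY : laurent := lmonom (0, 1).
Definition lYbar : laurent := lmonom (0, -1).

Lemma lXK : lX * lXbar = 1.
Proof. by rewrite [LHS]laurent_mulUU. Qed.

Lemma lYK : lY * lYbar = 1.
Proof. by rewrite [LHS]laurent_mulUU. Qed.

(* f n is the coefficient of t^n. *)
Definition fps (A : Type) := nat -> A.

Section PowerSeries.
Variable A : comNzRingType.
Implicit Types f g : fps A.

Definition fps_const (a : A) : fps A := fun n => a *+ (n == 0%N).

Definition fps_t : fps A := fun n => (n == 1%N)%:R.

Definition fps_sub f g : fps A := fun n => f n - g n.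

Definition fps_mul f g : fps A := fun n => \sum_(k < n.+1) f k * g (n - k)%N.

Fixpoint fps_inv_coefs f (n : nat) : seq A :=
  if n is m.+1 then
    let s := fps_inv_coefs f m in
    rcons s (- \sum_(k < m.+1) nth 0 s k * f (m.+1 - k)%N)
  else [:: 1].

(* The inverse of a power series with constant coefficient 1. *)
Definition fps_inv f : fps A := fun n => nth 0 (fps_inv_coefs f n) n.

Lemma fps_inv_coefsE f n k :
  (k <= n)%N -> nth 0 (fps_inv_coefs f n) k = fps_inv f k.
Proof.
have sz m : size (fps_inv_coefs f m) = m.+1.
  by elim: m => //= m IH; rewrite size_rcons IH.
elim: n => [|n IH]; first by rewrite leqn0 => /eqP ->.
rewrite leq_eqVlt => /predU1P[-> //|lekn].
by rewrite /= nth_rcons sz lekn IH.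
Qed.

Lemma fps_mul_inv f : f 0%N = 1 -> fps_mul (fps_inv f) f = fps_const 1.
Proof.
move=> f0; apply/funext => -[|n]; rewrite /fps_mul /fps_const.
  by rewrite big_ord1 subnn f0 mulr1.
have sz m : size (fps_inv_coefs f m) = m.+1.
  by elim: m => //= m IH; rewrite size_rcons IH.
rewrite big_ord_recr /= subnn f0 mulr1 {2}/fps_inv /= nth_rcons sz ltnn eqxx.
apply/eqP; rewrite subr_eq0; apply/eqP/eq_bigr => k _.
by rewrite fps_inv_coefsE // -ltnS.
Qed.

End PowerSeries.

(* Q(x, y; t) *)
Definition quadrant_gf (S : {fset lattice_point}) : fps laurent := fun n =>
  \sum_(ij \in [set: nat * nat])
    (quadrant_walks S ij.1 ij.2 n)%:R *: lmonom (ij.1%:Z, ij.2%:Z).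

(* [x^>= y^>=] *)
Definition nonneg_part (F : fps laurent) : fps laurent := fun n =>
  \sum_(u <- msupp (F n) | in_quadrant u) << (F n)@_u *g u >>.

(* p is the gcd of the lengths of the unconfined walks from 0 to 0. *)
Definition is_period (S : {fset lattice_point}) (p : nat) : Prop :=
  forall d : nat, (d %| p)%N <->
    (forall (n : nat) (w : n.-tuple S), position w = 0 -> (d %| n)%N).

Definition is_excursion_exponent (R : realType) (S : {fset lattice_point})
    (alpha : R) : Prop :=
  exists p : nat, is_period S p /\
  exists mu kappa1 kappa2 : R,
    [/\ 0 < mu, 0 < kappa1, 0 < kappa2 &
        \forall n \near \oo, (p %| n)%N ->
          kappa1 * mu ^+ n * n%:R `^ alpha <= (quadrant_walks S 0 0 n)%:R
            <= kappa2 * mu ^+ n * n%:R `^ alpha].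

Definition is_walk_exponent (R : realType) (S : {fset lattice_point})
    (alpha : R) : Prop :=
  exists (rho : R) (C : nat -> R),
    [/\ 0 < rho,
        forall n, 0 < C n,
        exists2 d : nat, (0 < d)%N & forall n, C (n + d)%N = C n &
        (fun n => (total_quadrant_walks S n)%:R : R) ~_\oo
          (fun n => C n * rho ^+ n * n%:R `^ alpha)].

Definition model : {fset lattice_point} :=
  [fset (1, 0); (1, -1); (-2, 1); (-2, 0)]%fset.

(* The right-hand side before extraction: N / (x^9 y^4 (1 - t S)) with N the
   numerator and S the step polynomial. *)
Definition model_series : fps laurent :=
  let x := lX in let xbar := lXbar in let y := lY in let ybar := lYbar in
  fps_mul
    (fps_const
      ((2 - y) * (x ^+ 3 - y ^+ 2)
        * (x ^+ 6 * y - 3 * x ^+ 3 * y - x ^+ 3 - y ^+ 2) * (x ^+ 3 - 2 * y)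
        * (xbar ^+ 9 * ybar ^+ 4)))
    (fps_inv
      (fps_sub (fps_const 1)
        (fps_mul (fps_t laurent)
          (fps_const (xbar ^+ 2 + xbar ^+ 2 * y + x * ybar + x))))).

(* Main.v *)
Require Import Defs.
From HB Require Import structures.
From mathcomp Require Import all_boot all_order all_algebra finmap monalg.
From mathcomp Require Import all_classical all_reals all_analysis.
From mathcomp Require Import ring lra zify.

Set Implicit Arguments.
Unset Strict Implicit.
Unset Printing Implicit Defensive.

Import Order.TTheory GRing.Theory Num.Theory.
Import numFieldNormedType.Exports.

Local Open Scope classical_set_scope.
Local Open Scope ring_scope.

(** The counts satisfy a one-step recurrence, obtained by removing the last
    step of a walk. No step increases a coordinate by more than one, so at
    quadrant points the recurrence refers only to points whose coordinates are
    at least -1. The hypergeometric expression satisfies the same recurrence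
    and vanishes for i = -1 and for j = -1, because of its factors i + 1 and
    j + 1; hence the two agree ([walk_countE]). With 1 / z! extended by 0 to
    negative integers z, the rule 1 / (z - 1)! = z / z! holds everywhere
    ([rfactP]), and the recurrence becomes one polynomial identity in i, j, m.

    The step polynomial is (1 + y)(x / y + 1 / x^2), so the coefficients of its
    powers are products of two binomial coefficients ([step_poly_exp_coef]).
    Multiplication by the numerator turns them into combinations of fourteen
    such products. Those products are all polynomial multiples of one product
    of reciprocal factorials, and their sum is the same hypergeometric
    expression ([numerator_coef]), again by a polynomial identity.

    For the exponents, write n = i + 3 j + 3 m. The four factorials in the
    denominator pair up, and the count becomes 'C(n, m) 'C(n, m + j) times a
    rational function of order n^-4 for fixed i and j ([quadrant_walks_bin]).
    For n = 3 N + r both binomial coefficients have limiting ratios to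
    'C(3 N, N), and N 'C(3 N, N)^2 (16 / 729)^N converges to a positive limit,
    being nondecreasing and bounded ([cvg_thirds_sq]). Every fixed endpoint
    thus contributes the order n^-5 with the growth rate 729 / 16 = (27 / 4)^2
    for three steps; the origin gives the excursion exponent. For all walks,
    the endpoints with i = r + 3 (k - j) and n = 3 N + r contribute at most a
    polynomial in k times 2^-k, uniformly in N ([walk_term_le]), because the
    binomial coefficients of n at least double from one lower index to the
    next below n / 3. Tannery's theorem ([tannery]) then gives a positive limit
    for the whole sum in each residue class r of n modulo 3. *)

(** * Removing the last step of a walk *)

(** Endpoints range over the whole plane, so that the recurrence has no
    boundary cases; outside the quadrant the count is zero. *)
Definition walk_count (S : {fset lattice_point}) (n : nat)
    (z : lattice_point) : nat :=
  #|[pred w : n.-tuple S | stays_in_quadrant w && (position w == z)]|.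

Lemma quadrant_walksE S i j n :
  quadrant_walks S i j n = walk_count S n (i%:Z, j%:Z).
Proof. by []. Qed.

Lemma position_rcons (S : {fset lattice_point}) (w : seq S) (s : S) :
  position (rcons w s) = position w + val s.
Proof. by rewrite /position -cats1 big_cat big_seq1. Qed.

Lemma stays_in_quadrant_rcons (S : {fset lattice_point}) (w : seq S) (s : S) :
  stays_in_quadrant (rcons w s)
    = stays_in_quadrant w && in_quadrant (position w + val s).
Proof.
rewrite /stays_in_quadrant size_rcons.
rewrite -[in LHS]addn1 iotaD all_cat /= add0n andbT.
have -> : take (size w).+1 (rcons w s) = rcons w s.
  by rewrite -(size_rcons w s) take_size.
rewrite position_rcons.
rewrite !take0; do 2!congr andb; apply: eq_in_all => k.
by rewrite mem_iota add1n ltnS => /andP[_ kw]; rewrite -cats1 takel_cat.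
Qed.

Lemma stays_in_quadrant_end (S : {fset lattice_point}) (w : seq S) :
  stays_in_quadrant w -> in_quadrant (position w).
Proof.
by move=> /allP /(_ (size w)); rewrite mem_iota take_size ltnSn; apply.
Qed.

Lemma walk_count_out S n z : ~~ in_quadrant z -> walk_count S n z = 0%N.
Proof.
move=> zN; apply: eq_card0 => w; rewrite !inE.
by apply/negP => /andP[/stays_in_quadrant_end + /eqP wz]; rewrite wz (negbTE zN).
Qed.

Lemma walk_count0 S z : walk_count S 0 z = (z == 0).
Proof.
have E (w : 0.-tuple S) :
    stays_in_quadrant w && (position w == z) = (z == 0).
  by rewrite tuple0 /stays_in_quadrant /= /position big_nil eq_sym.
rewrite /walk_count (eq_card (B := [pred w : 0.-tuple S | z == 0])); last first.
  by move=> w; rewrite !inE E.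
case: (z == 0); last exact: eq_card0.
by rewrite (eq_card (B := predT)) ?card_tuple //.
Qed.

Lemma rcons_tuple_bij (S : finType) n :
  bijective (fun p : n.-tuple S * S => [tuple of rcons p.1 p.2]).
Proof.
apply: inj_card_bij; last by rewrite card_prod !card_tuple expnS mulnC.
move=> [u s] [v t] /= /(congr1 val) /= /rcons_inj [+ ->].
by move=> uv; congr pair; apply: val_inj.
Qed.

Lemma walk_countS S n z : in_quadrant z ->
  walk_count S n.+1 z = (\sum_(s <- S) walk_count S n (z - s)%R)%N.
Proof.
move=> zQ; rewrite big_seq_fsetE /=.
rewrite /walk_count -sum1_card (reindex _ (onW_bij _ (@rcons_tuple_bij S n))) /=.
rewrite (eq_bigl (fun p : n.-tuple S * S => true && (stays_in_quadrant p.1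
    && (position p.1 == z - val p.2)))) => [|[w s]] /=; last first.
  rewrite !inE stays_in_quadrant_rcons position_rcons -andbA; congr andb.
  rewrite [RHS]eq_sym subr_eq [RHS]eq_sym; case: eqP => [->|]; last by rewrite andbF.
  by rewrite zQ.
rewrite -(pair_big_dep predT (fun (w : n.-tuple S) (s : S) => stays_in_quadrant w
    && (position w == z - val s)) (fun _ _ => 1%N)) /=.
rewrite (exchange_big_dep predT) //=; apply: eq_bigr => s _.
by rewrite sum1_card; apply: eq_card => w; rewrite !inE.
Qed.

Lemma sum_model (V : nmodType) (F : lattice_point -> V) :
  \sum_(s <- model) F s
    = F (1, 0) + F (1, -1) + F (-2, 1) + F (-2, 0).
Proof.
rewrite /model -!fsetUA !big_fsetU1 ?big_seq_fset1 ?inE //=.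
by rewrite !addrA.
Qed.

Lemma model_walkS n (i j : int) : 0 <= i -> 0 <= j ->
  walk_count model n.+1 (i, j)
    = walk_count model n (i - 1, j) + walk_count model n (i - 1, j + 1)
       + walk_count model n (i + 2, j - 1) + walk_count model n (i + 2, j).
Proof.
move=> i0 j0; rewrite walk_countS /in_quadrant /= ?i0 //.
rewrite (sum_model (fun s => walk_count model n ((i, j) - s))).
congr ((_ + _ + _ + _)%R); congr (walk_count _ _ (_, _)) => /=; lia.
Qed.

(** * The counting formula *)

Definition rfact (z : int) : rat := if z is Posz k then (k`!%:R)^-1 else 0.

Lemma rfact_neg z : z < 0 -> rfact z = 0.
Proof. by case: z. Qed.

(** At z <= 0 both sides vanish. This is what makes identities between products
    of factorials polynomial, with no case distinction at the boundary. *)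
Lemma rfactP z : rfact (z - 1) = z%:~R * rfact z.
Proof.
case: z => [[|k]|k]; rewrite ?mul0r ?mulr0 //.
rewrite (_ : Posz k.+1 - 1 = Posz k); last by lia.
by rewrite /= factS natrM invfM mulrA divff ?mul1r // pnatr_eq0.
Qed.

Definition walk_formula (n : nat) (i j m : int) : rat :=
  ((i + 1) * (j + 1) * (i + 3 * j + 4)
    * ((i + 2 * j + 2) * (i + 2 * j + 3) + m * (2 * i + 3 * j + 4)))%:~R
  * n`!%:R * (n + 3)`!%:R
  * (rfact m * rfact (m + j + 1) * rfact (2 * m + i + 2 * j + 3)
     * rfact (2 * m + i + 3 * j + 4)).

Lemma walk_formula_nat (i j n m : nat) :
  walk_formula n i j m
    = ((i + 1) * (j + 1) * (i + 3 * j + 4)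
            * ((i + 2 * j + 2) * (i + 2 * j + 3) + m * (2 * i + 3 * j + 4))
            * n`! * (n + 3)`!)%N%:R
          / (m`! * (m + j + 1)`! * (2 * m + i + 2 * j + 3)`!
            * (2 * m + i + 3 * j + 4)`!)%N%:R.
Proof.
rewrite /walk_formula.
have -> : 2 * m%:Z + i%:Z + 2 * j%:Z + 3 = (2 * m + i + 2 * j + 3)%N by lia.
have -> : 2 * m%:Z + i%:Z + 3 * j%:Z + 4 = (2 * m + i + 3 * j + 4)%N by lia.
have -> : m%:Z + j%:Z + 1 = (m + j + 1)%N by lia.
rewrite /rfact -!invfM -!natrM; congr (_ / _).
Qed.

Lemma walk_formula_out n (i j m : int) : i = -1 \/ j = -1 ->
  walk_formula n i j m = 0.
Proof. by rewrite /walk_formula => -[] ->; rewrite addNr ?(mulr0, mul0r). Qed.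

(** The five terms are polynomial multiples of one product of four reciprocal
    factorials; once n is expressed by i, j and m, the claim is an identity
    between polynomials. *)
Lemma walk_formulaS n (i j m : int) : n.+1%:Z = i + 3 * j + 3 * m ->
  walk_formula n.+1 i j m
    = walk_formula n (i - 1) j m + walk_formula n (i - 1) (j + 1) (m - 1)
      + walk_formula n (i + 2) (j - 1) m + walk_formula n (i + 2) j (m - 1).
Proof.
move=> nE; rewrite /walk_formula.
have nQ : n%:R = i%:~R + 3 * j%:~R + 3 * m%:~R - 1 :> rat.
  by have := congr1 (fun z : int => z%:~R : rat) nE; rewrite !rmorphD !rmorphM /= -natr1; lra.
have -> : (n.+1 + 3 = (n + 3).+1)%N by [].
rewrite !factS [in LHS]natrM [(_ * (n + 3)`!)%N%:R]natrM -!natr1 natrD nQ.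
set M := rfact m; set B := rfact (m + j + 1).
set C := rfact (2 * m + i + 2 * j + 3); set D := rfact (2 * m + i + 3 * j + 4).
have M1 : rfact (m - 1) = m%:~R * M by rewrite rfactP.
have B1 : rfact (m + j) = (m + j + 1)%:~R * B by rewrite -rfactP addrK.
have C1 : rfact (2 * m + i + 2 * j + 2) = (2 * m + i + 2 * j + 3)%:~R * C.
  by rewrite -rfactP; congr rfact; lia.
have D1 : rfact (2 * m + i + 3 * j + 3) = (2 * m + i + 3 * j + 4)%:~R * D.
  by rewrite -rfactP; congr rfact; lia.
have -> : m - 1 + (j + 1) + 1 = m + j + 1 by lia.
have -> : m + (j - 1) + 1 = m + j by lia.
have -> : m - 1 + j + 1 = m + j by lia.
have -> : 2 * m + (i - 1) + 2 * j + 3 = 2 * m + i + 2 * j + 2 by lia.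
have -> : 2 * m + (i - 1) + 3 * j + 4 = 2 * m + i + 3 * j + 3 by lia.
have -> : 2 * (m - 1) + (i - 1) + 2 * (j + 1) + 3 = 2 * m + i + 2 * j + 2 by lia.
have -> : 2 * (m - 1) + (i - 1) + 3 * (j + 1) + 4 = 2 * m + i + 3 * j + 4 by lia.
have -> : 2 * m + (i + 2) + 2 * (j - 1) + 3 = 2 * m + i + 2 * j + 3 by lia.
have -> : 2 * m + (i + 2) + 3 * (j - 1) + 4 = 2 * m + i + 3 * j + 3 by lia.
have -> : 2 * (m - 1) + (i + 2) + 2 * j + 3 = 2 * m + i + 2 * j + 3 by lia.
have -> : 2 * (m - 1) + (i + 2) + 3 * j + 4 = 2 * m + i + 3 * j + 4 by lia.
rewrite -/M -/B -/C -/D M1 B1 C1 D1.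
ring.
Qed.

(** If i or j is positive then m is negative, and the factor 1 / m! is zero. *)
Lemma walk_formula0 (i j m : int) : 0 <= i -> 0 <= j ->
  i + 3 * j + 3 * m = 0 -> walk_formula 0 i j m = ((i, j) == 0)%:R.
Proof.
move=> i0 j0 E; rewrite -pair_eqE /=.
case: (eqVneq i 0) => [iE|iN] /=; last first.
  by rewrite /walk_formula rfact_neg ?(mul0r, mulr0) //; lia.
case: (eqVneq j 0) => [jE|jN] /=; last first.
  by rewrite /walk_formula rfact_neg ?(mul0r, mulr0) //; lia.
have mE : m = 0 by lia.
by rewrite iE jE mE.
Qed.

(** The range of i and j starts at -1 because the recurrence at a quadrant point
    reaches the lines i = -1 and j = -1, on which both sides vanish. *)
Lemma walk_countE n (i j m : int) : -1 <= i -> -1 <= j ->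
  n%:Z = i + 3 * j + 3 * m ->
  (walk_count model n (i, j))%:R = walk_formula n i j m.
Proof.
elim: n i j m => [|n IH] i j m i1 j1 nE.
all: have [[i0 j0]|ij] : (0 <= i /\ 0 <= j) \/ (i = -1 \/ j = -1) by lia.
all: try by rewrite walk_formula_out // walk_count_out // /in_quadrant /=; lia.
  by rewrite walk_count0 walk_formula0.
rewrite model_walkS // walk_formulaS // !natrD.
by congr (_ + _ + _ + _); apply: IH; lia.
Qed.

(** Every step changes the first coordinate by 1 modulo 3. *)
Lemma walk_count_mod3 n (i j : int) : ~~ (3 %| (n%:Z - i))%Z ->
  walk_count model n (i, j) = 0%N.
Proof.
elim: n i j => [|n IH] i j niN.
  rewrite walk_count0; case: eqP => // -[i0 _]; move: niN; rewrite i0; lia.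
have [/andP[i0 j0]|ij] := boolP (in_quadrant (i, j)); last exact: walk_count_out.
rewrite model_walkS // !IH //; lia.
Qed.

(** * Coefficients of the Laurent series *)

Lemma fps_inv_coef (A : comNzRingType) (f : fps A) n :
  f 0%N = 1 -> \sum_(k < n.+1) fps_inv f k * f (n - k)%N = (n == 0%N)%:R.
Proof. by move=> /fps_mul_inv /(congr1 (fun g : fps A => g n)). Qed.

Lemma fps_inv_geometric (A : comNzRingType) (a : A) n :
  fps_inv (fps_sub (fps_const 1) (fps_mul (fps_t A) (fps_const a))) n = a ^+ n.
Proof.
set f := fps_sub _ _.
have fE k : f k = (k == 0%N)%:R - a *+ (k == 1%N).
  rewrite /f /fps_sub /fps_const /fps_mul /fps_t; congr (_ - _).
  case: k => [|k]; first by rewrite big_ord1 mul0r.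
  rewrite 2!big_ord_recl /= mul0r add0r mul1r big1 ?addr0 => [|l _]; last first.
    by rewrite mul0r.
  by rewrite subSS subn0.
have f0 : f 0%N = 1 by rewrite fE subr0.
elim: n => [|n IH].
  by have := fps_inv_coef 0 f0; rewrite big_ord1 f0 mulr1.
have := fps_inv_coef n.+1 f0; rewrite !big_ord_recr /= subnn f0 mulr1 subSnn fE.
rewrite big1 => [|k _]; last first.
  rewrite fE; have kn := ltn_ord k.
  by rewrite (_ : n.+1 - k = (n - k.+1).+2)%N ?mulr0 ?subr0 ?mulr0 //; lia.
rewrite add0r sub0r mulr1n mulrN => /eqP.
by rewrite addrC subr_eq0 => /eqP ->; rewrite IH exprSr.
Qed.

Lemma lmonomM u v : lmonom u * lmonom v = lmonom (u + v).
Proof. by rewrite [LHS]laurent_mulUU mulr1. Qed.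

(** Giving the coefficient functional a name of its own fixes the structures it
    is additive for. *)
Definition lcoef (u : lattice_point) (f : laurent) : rat := f@_u.

Lemma lcoefD u : {morph lcoef u : f g / f + g}.
Proof. exact: mcoeffD. Qed.

Lemma lcoef_lmonom u v : lcoef v (lmonom u) = (u == v)%:R.
Proof. exact: mcoeffU. Qed.

Lemma lcoefN u : {morph lcoef u : f / - f}.
Proof. exact: mcoeffN. Qed.

Lemma lcoefM u v (f : laurent) : lcoef v (lmonom u * f) = lcoef (v - u) f.
Proof.
rewrite /lcoef [f]monalgE mulr_sumr !raddf_sum /=; apply: eq_bigr => w _.
rewrite [lmonom u * _]laurent_mulUU mul1r !mcoeffU.
by rewrite [RHS](_ : _ = f@_w *+ (u + w == v)) // eq_sym subr_eq addrC eq_sym.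
Qed.

Lemma pair_mulrn (U V : nmodType) (u : U) (v : V) n :
  (u, v) *+ n = (u *+ n, v *+ n).
Proof. by elim: n => // n IH; rewrite !mulrS IH. Qed.

(** The expansions take place in an abstract ring with monomials: there two
    monomials are compared through their exponents alone, whereas a conversion
    test between distinct elements of [laurent] unfolds the finitely supported
    functions that represent them. *)
Section CoefficientExtraction.
Variables (A : comNzRingType) (mono : lattice_point -> A).
Variable coef : lattice_point -> A -> rat.
Hypothesis mono0 : mono 0 = 1.
Hypothesis monoM : forall u v, mono u * mono v = mono (u + v).
Hypothesis coefD : forall u, {morph coef u : f g / f + g}.
Hypothesis coefN : forall u, {morph coef u : f / - f}.
Hypothesis coefM : forall u v f, coef v (mono u * f) = coef (v - u) f.

Let x := mono (1, 0).
Let xbar := mono (-1, 0).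
Let y := mono (0, 1).
Let ybar := mono (0, -1).

Lemma monoX u n : mono u ^+ n = mono (u *+ n).
Proof. by elim: n => [|n IH]; rewrite ?mono0 // exprS IH monoM mulrS. Qed.

Lemma coefMn u n : {morph coef u : f / f *+ n}.
Proof.
move=> f; elim: n => [|n IH]; last by rewrite !mulrS coefD IH.
by apply: (@addrI _ (coef u 0)); rewrite -coefD !addr0.
Qed.

Lemma coef_stepM (f : A) (a b : int) :
  coef (a, b) ((xbar ^+ 2 + xbar ^+ 2 * y + x * ybar + x) * f)
    = coef (a + 2, b) f + coef (a + 2, b - 1) f + coef (a - 1, b + 1) f
      + coef (a - 1, b) f.
Proof.
rewrite !monoX !monoM !mulrDl !coefD !coefM.
by congr (_ + _ + _ + _); congr (coef (_, _) _) => /=; lia.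
Qed.

Lemma numerator_monomials :
  (2 - y) * (x ^+ 3 - y ^+ 2)
    * (x ^+ 6 * y - 3 * x ^+ 3 * y - x ^+ 3 - y ^+ 2) * (x ^+ 3 - 2 * y)
    * (xbar ^+ 9 * ybar ^+ 4)
  = mono (-9, 2) *+ 2
    + mono (-6, 1) *+ 5
    + mono (-3, -3) *+ 4
    + mono (-3, -2) *+ 10
    + mono (-3, 0)
    + mono (0, 0)
    + mono (3, -3) *+ 2
    - (mono (-9, 1) *+ 4
       + mono (-6, 0) *+ 10
       + mono (-3, 1) *+ 2
       + mono (0, -4) *+ 2
       + mono (0, -3) *+ 5
       + mono (0, -2)
       + mono (3, -2)).
Proof.
(* p and q are the exponents before the division by x^9 y^4. *)
have E (p q : nat) :
    mono (p%:Z - 9, q%:Z - 4) = x ^+ p * y ^+ q * xbar ^+ 9 * ybar ^+ 4.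
  rewrite !monoX !monoM !pair_mulrn; congr mono; rewrite !mul0rn -!natz.
  by congr pair; rewrite /= ?addr0 ?add0r mulNrn.
rewrite (E 0 6 : mono (-9, 2) = _) (E 3 5 : mono (-6, 1) = _).
rewrite (E 6 1 : mono (-3, -3) = _) (E 6 2 : mono (-3, -2) = _).
rewrite (E 6 4 : mono (-3, 0) = _) (E 9 4 : mono (0, 0) = _).
rewrite (E 12 1 : mono (3, -3) = _) (E 0 5 : mono (-9, 1) = _).
rewrite (E 3 4 : mono (-6, 0) = _) (E 6 5 : mono (-3, 1) = _).
rewrite (E 9 0 : mono (0, -4) = _) (E 9 1 : mono (0, -3) = _).
rewrite (E 9 2 : mono (0, -2) = _) (E 12 2 : mono (3, -2) = _).
clearbody x y xbar ybar; ring.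
Qed.

Lemma coef_numeratorM (f : A) (a b : int) :
  coef (a, b) ((2 - y) * (x ^+ 3 - y ^+ 2)
    * (x ^+ 6 * y - 3 * x ^+ 3 * y - x ^+ 3 - y ^+ 2) * (x ^+ 3 - 2 * y)
    * (xbar ^+ 9 * ybar ^+ 4) * f)
  = coef (a + 9, b - 2) f *+ 2
      + coef (a + 6, b - 1) f *+ 5
      + coef (a + 3, b + 3) f *+ 4
      + coef (a + 3, b + 2) f *+ 10
      + coef (a + 3, b) f
      + coef (a, b) f
      + coef (a - 3, b + 3) f *+ 2
      - (coef (a + 9, b - 1) f *+ 4
         + coef (a + 6, b) f *+ 10
         + coef (a + 3, b - 1) f *+ 2
         + coef (a, b + 4) f *+ 2
         + coef (a, b + 3) f *+ 5
         + coef (a, b + 2) f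
         + coef (a - 3, b + 2) f).
Proof.
rewrite numerator_monomials !(mulrDl, mulNr, mulrnAl).
rewrite !(coefD, coefN, coefMn, coefM).
have E (u v : lattice_point) : u.1 = v.1 -> u.2 = v.2 -> coef u f = coef v f.
  by case: u v => [u1 u2] [v1 v2] /= -> ->.
by do ?[congr (_ *+ _) | congr (_ + _) | congr (- _)]; apply: E => /=; lia.
Qed.

End CoefficientExtraction.

Definition step_poly : laurent := lXbar ^+ 2 + lXbar ^+ 2 * lY + lX * lYbar + lX.

Lemma lcoef_step_polyM (f : laurent) (a b : int) :
  lcoef (a, b) (step_poly * f)
    = lcoef (a + 2, b) f + lcoef (a + 2, b - 1) f + lcoef (a - 1, b + 1) f
      + lcoef (a - 1, b) f.
Proof.
exact: (coef_stepM (mono := lmonom) (coef := lcoef) (erefl _) lmonomM lcoefD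
  lcoefM).
Qed.

(** The binomial coefficient of n and l, which is 0 for integers l outside the
    range from 0 to n. *)
Definition int_bin (n : nat) (l : int) : rat :=
  n`!%:R * rfact l * rfact (n%:Z - l).

Lemma int_binS n l : int_bin n.+1 l = int_bin n l + int_bin n (l - 1).
Proof.
rewrite /int_bin rfactP (_ : n%:Z - l = n.+1%:Z - l - 1); last lia.
rewrite (_ : n%:Z - (l - 1) = n.+1%:Z - l); last lia.
rewrite rfactP factS natrM rmorphB /= -pmulrn; ring.
Qed.

Lemma int_bin0 l : int_bin 0 l = (l == 0)%:R.
Proof.
rewrite /int_bin; case: eqVneq => [->|lN] //.
have [l0|l0] : l < 0 \/ 0 - l < 0 by lia.
  by rewrite (rfact_neg l0) mulr0 mul0r.
by rewrite (rfact_neg l0) mulr0.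
Qed.

(** In the n-th power of (1 + y)(x / y + 1 / x^2), let l be the number of factors
    1 / x^2 and k the number of factors 1 that are chosen. The induction is
    Pascal's rule for both binomial coefficients at once. *)
Lemma step_poly_exp_coef n (l k : int) :
  lcoef (n%:Z - 3 * l, l - k) (step_poly ^+ n) = int_bin n l * int_bin n k.
Proof.
elim: n l k => [|n IH] l k.
  rewrite expr0 lcoef_lmonom !int_bin0 -natrM mulnb -pair_eqE /=.
  by congr (nat_of_bool _)%:R; lia.
rewrite exprS lcoef_step_polyM !int_binS.
rewrite (_ : (_ + 2, _ - 1) = (n%:Z - 3 * (l - 1), (l - 1) - k)); last first.
  by congr pair; lia.
rewrite (_ : (_ + 2, _) = (n%:Z - 3 * (l - 1), (l - 1) - (k - 1))); last first.
  by congr pair; lia.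
rewrite (_ : (_ - 1, _ + 1) = (n%:Z - 3 * l, l - (k - 1))); last first.
  by congr pair; lia.
rewrite (_ : (_ - 1, _) = (n%:Z - 3 * l, l - k)); last first.
  by congr pair; lia.
by rewrite !IH; ring.
Qed.

Lemma step_poly_exp_mod3 n (a b : int) : ~~ (3 %| (n%:Z - a))%Z ->
  lcoef (a, b) (step_poly ^+ n) = 0.
Proof.
elim: n a b => [|n IH] a b naN.
  by rewrite expr0 lcoef_lmonom; case: eqP => // -[a0 _]; move: naN; rewrite -a0; lia.
by rewrite exprS lcoef_step_polyM !IH ?addr0 //; lia.
Qed.

Lemma rfact_subn z :
  [/\ rfact (z - 2) = z%:~R * (z%:~R - 1) * rfact z,
      rfact (z - 3) = z%:~R * (z%:~R - 1) * (z%:~R - 2) * rfact z &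
      rfact (z - 4)
        = z%:~R * (z%:~R - 1) * (z%:~R - 2) * (z%:~R - 3) * rfact z].
Proof.
have E k : rfact (z - k - 1) = (z%:~R - k%:~R) * rfact (z - k).
  by rewrite rfactP rmorphB.
have -> : z - 2 = z - 1 - 1 by lia.
have -> : z - 3 = z - 2 - 1 by lia.
have -> : z - 4 = z - 3 - 1 by lia.
rewrite (E 3) (_ : z - 3 = z - 2 - 1) ?(E 2); last by lia.
rewrite (_ : z - 2 = z - 1 - 1) ?(E 1) ?rfactP; last by lia.
by split; ring.
Qed.

Definition model_numerator : laurent :=
  (2 - lY) * (lX ^+ 3 - lY ^+ 2)
    * (lX ^+ 6 * lY - 3 * lX ^+ 3 * lY - lX ^+ 3 - lY ^+ 2) * (lX ^+ 3 - 2 * lY)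
    * (lXbar ^+ 9 * lYbar ^+ 4).

(** Each of the fourteen monomials of the numerator contributes a product of two
    binomial coefficients of n with lower indices m + j + 1 - s and m - t, for s
    and t between 0 and 4. Such a product is a polynomial multiple of n!^2
    times the four reciprocal factorials of the formula, and what remains is a
    polynomial identity of degree 8 in i, j and m. *)
Lemma numerator_coef n (i j m : int) : n%:Z = i + 3 * j + 3 * m ->
  lcoef (i, j) (model_numerator * step_poly ^+ n) = walk_formula n i j m.
Proof.
move=> nE.
rewrite [LHS](coef_numeratorM (mono := lmonom) (coef := lcoef) (erefl _) lmonomM
  lcoefD lcoefN lcoefM).
have SC (a b s t : int) :
    a = i + 3 * s - 3 -> b = j + t - s + 1 ->
    lcoef (a, b) (step_poly ^+ n) = int_bin n (m + j + 1 - s) * int_bin n (m - t).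
  move=> -> ->; rewrite -step_poly_exp_coef.
  by congr (lcoef (_, _) _); lia.
rewrite (SC (i + 9) (j - 2) 4 1); [|lia|lia].
rewrite (SC (i + 6) (j - 1) 3 1); [|lia|lia].
rewrite (SC (i + 3) (j + 3) 2 4); [|lia|lia].
rewrite (SC (i + 3) (j + 2) 2 3); [|lia|lia].
rewrite (SC (i + 3) j 2 1); [|lia|lia].
rewrite (SC i j 1 0); [|lia|lia].
rewrite (SC (i - 3) (j + 3) 0 2); [|lia|lia].
rewrite (SC (i + 9) (j - 1) 4 2); [|lia|lia].
rewrite (SC (i + 6) j 3 2); [|lia|lia].
rewrite (SC (i + 3) (j - 1) 2 0); [|lia|lia].
rewrite (SC i (j + 4) 1 4); [|lia|lia].
rewrite (SC i (j + 3) 1 3); [|lia|lia].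
rewrite (SC i (j + 2) 1 2); [|lia|lia].
rewrite (SC (i - 3) (j + 2) 0 1); [|lia|lia].
(* The arguments of the reciprocal factorials in [walk_formula] are the largest
   that occur; every other one is reached by subtracting at most 4. *)
have bin_mj (s s' : int) : s + s' = 4 -> int_bin n (m + j + 1 - s)
    = n`!%:R * rfact (m + j + 1 - s) * rfact (2 * m + i + 2 * j + 3 - s').
  by move=> ss; rewrite /int_bin; congr (_ * rfact _); lia.
have bin_m (t t' : int) : t + t' = 4 -> int_bin n (m - t)
    = n`!%:R * rfact (m - t) * rfact (2 * m + i + 3 * j + 4 - t').
  by move=> tt; rewrite /int_bin; congr (_ * rfact _); lia.
rewrite (bin_mj 0 4) // (bin_mj 1 3) // (bin_mj 2 2) // (bin_mj 3 1) //.
rewrite (bin_mj 4 0) // (bin_m 0 4) // (bin_m 1 3) // (bin_m 2 2) //.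
rewrite (bin_m 3 1) // (bin_m 4 0) // !subr0 !rfactP.
have nQ : n%:R = i%:~R + 3 * j%:~R + 3 * m%:~R :> rat.
  by have := congr1 (fun z : int => z%:~R : rat) nE; rewrite !rmorphD !rmorphM.
rewrite /walk_formula addn3 !factS !natrM -!natr1 nQ.
have [-> -> ->] := rfact_subn m.
have [-> -> ->] := rfact_subn (m + j + 1).
have [-> -> ->] := rfact_subn (2 * m + i + 2 * j + 3).
have [-> -> ->] := rfact_subn (2 * m + i + 3 * j + 4).
move: (rfact m) (rfact (m + j + 1)) (rfact (2 * m + i + 2 * j + 3)).
move: (rfact (2 * m + i + 3 * j + 4)) (n`!%:R : rat) => D F M B C.
by clear; ring.
Qed.

Lemma numerator_coef_mod3 n (i j : int) : ~~ (3 %| (n%:Z - i))%Z ->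
  lcoef (i, j) (model_numerator * step_poly ^+ n) = 0.
Proof.
move=> niN.
rewrite [LHS](coef_numeratorM (mono := lmonom) (coef := lcoef) (erefl _) lmonomM
  lcoefD lcoefN lcoefM).
rewrite !step_poly_exp_mod3; try lia.
by rewrite !mul0rn !addr0.
Qed.

Lemma model_seriesE n : model_series n = model_numerator * step_poly ^+ n.
Proof.
rewrite /model_series /fps_mul big_ord_recl subn0 /fps_const /= mulr1n.
rewrite [X in _ + X]big1 => [|k _]; last by rewrite mulr0n mul0r.
by rewrite addr0; congr (_ * _); exact: fps_inv_geometric.
Qed.

Lemma model_series_coef n (i j : int) : in_quadrant (i, j) ->
  lcoef (i, j) (model_series n) = (walk_count model n (i, j))%:R.
Proof.
move=> /andP[/= i0 j0]; rewrite model_seriesE.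
have [ni|niN] := boolP (3 %| (n%:Z - i))%Z.
  have nE : n%:Z = i + 3 * j + 3 * (((n%:Z - i)%R %/ 3)%Z - j) by lia.
  by rewrite (numerator_coef nE) (walk_countE _ _ nE) //; lia.
by rewrite numerator_coef_mod3 // walk_count_mod3.
Qed.

(** * The generating function *)

Lemma nonneg_part_coef F n u :
  lcoef u (nonneg_part F n) = if in_quadrant u then lcoef u (F n) else 0.
Proof.
rewrite /lcoef /nonneg_part raddf_sum /=.
under eq_bigr => v _ do rewrite mcoeffU.
case: ifP => uQ; last first.
  by rewrite big1 // => v vQ; case: eqP => // vu; rewrite vu uQ in vQ.
rewrite [in RHS](monalgE (F n)) raddf_sum /= big_mkcond /=.
apply: eq_bigr => v _; rewrite mcoeffU.
by case: eqP => [->|_]; [rewrite uQ | case: ifP].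
Qed.

Lemma quadrant_gf_coef (S : {fset lattice_point}) n u :
  lcoef u (quadrant_gf S n) = (walk_count S n u)%:R.
Proof.
have finS := finite_quadrant_walks S n.
rewrite /quadrant_gf (fsbigTE (fset_set
    [set ij : nat * nat | quadrant_walks S ij.1 ij.2 n != 0%N]%classic)); last first.
  move=> ij; rewrite in_fset_set // => /negP ijN; apply/eqP; rewrite scaler_eq0.
  by apply/orP; left; rewrite pnatr_eq0; apply: contra_notT ijN => ijN; rewrite inE.
rewrite /lcoef raddf_sum /=.
under eq_bigr => ij _ do rewrite mcoeffZ mcoeffU mulr_natr.
have [uQ|uQ] := boolP (in_quadrant u); last first.
  rewrite walk_count_out // big1 // => ij _.
  by case: eqP uQ => [<- /negP[]|_ _]; rewrite ?mulr0n.
case: u uQ => [[i|//] [j|//]] _; rewrite -[walk_count _ _ _]quadrant_walksE.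
case: (boolP ((i, j) \in fset_set
    [set ij : nat * nat | quadrant_walks S ij.1 ij.2 n != 0%N]%classic)) => ijS.
  rewrite (bigD1_seq (i, j)) ?fset_uniq //= eqxx mulr1n big1 ?addr0 //.
  move=> [k l] /=; rewrite -!pair_eqE /= => /negbTE.
  by rewrite !eqz_nat => ->.
rewrite big1_seq => [|[k l] /= klS]; last first.
  case: eqP => //= -[ki lj]; by move: ijS; rewrite -ki -lj klS.
move: ijS; rewrite in_fset_set // => /negP ijN.
by apply/esym/eqP; rewrite pnatr_eq0; apply: contra_notT ijN => ijN; rewrite inE.
Qed.

Lemma quadrant_gf_model : quadrant_gf model = nonneg_part model_series.
Proof.
apply/funext => n; apply/malgP => -[i j].
change (lcoef (i, j) (quadrant_gf model n)
  = lcoef (i, j) (nonneg_part model_series n)).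
rewrite quadrant_gf_coef nonneg_part_coef.
case: ifP => ijQ; first by rewrite model_series_coef.
by rewrite walk_count_out ?ijQ.
Qed.

(** * Limits of sequences *)

Lemma geometric_tail_le (R : realType) (K g : R) (M P : nat) :
  0 <= K -> 0 <= g < 1 ->
  \sum_(M <= k < P) K * g ^+ k <= K * g ^+ M / (1 - g).
Proof.
move=> K0 /andP[g0 g1].
have g1' : 0 < 1 - g by lra.
have [PM|/ltnW MP] := leqP P M.
  by rewrite big_geq // divr_ge0 ?mulr_ge0 ?exprn_ge0 // ltW.
suff E : \sum_(M <= k < P) K * g ^+ k = K * (g ^+ M - g ^+ P) / (1 - g).
  rewrite E ler_pM2r ?invr_gt0 // ler_wpM2l // gerBl exprn_ge0 //.
elim: P MP => [|P IH]; first by rewrite leqn0 => /eqP->; rewrite big_geq // subrr mulr0 mul0r.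
rewrite leq_eqVlt => /predU1P[<-|MP]; first by rewrite big_geq // subrr mulr0 mul0r.
rewrite big_nat_recr //= IH // exprS.
by field; rewrite gt_eqF.
Qed.

Lemma cvg_sum_seq (R : realType) (I : Type) (r : seq I) (F : I -> nat -> R) (G : I -> R) :
  (forall i, F i N @[N --> \oo] --> G i) ->
  \sum_(i <- r) F i N @[N --> \oo] --> \sum_(i <- r) G i.
Proof.
move=> FG; elim: r => [|i r IH].
  by rewrite big_nil; under eq_fun do rewrite big_nil; exact: cvg_cst.
rewrite big_cons; under eq_fun do rewrite big_cons.
exact: cvgD.
Qed.

(** Tannery's theorem: under a summable bound that does not depend on N, the
    limit may be taken term by term although the number of terms grows. The
    comparison of the limit with its first term serves to show that it is
    positive. *)
Lemma tannery (R : realType) (F : nat -> nat -> R) (G : nat -> R) (K g : R) :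
  0 <= K -> 0 <= g < 1 ->
  (forall N k, (k <= N)%N -> 0 <= F N k <= K * g ^+ k) ->
  (forall k, F N k @[N --> \oo] --> G k) ->
  exists2 S, \sum_(0 <= k < N.+1) F N k @[N --> \oo] --> S & G 0%N <= S.
Proof.
move=> K0 g01 FK FG.
have [g0 g1] := andP g01.
have GK k : 0 <= G k <= K * g ^+ k.
  apply/andP; split.
    apply: (cvgr_to_ge (FG k)); near=> N.
    by have /(FK N)/andP[] : (k <= N)%N by near: N; exact: nbhs_infty_ge.
  apply: (cvgr_to_le (FG k)); near=> N.
  by have /(FK N)/andP[] : (k <= N)%N by near: N; exact: nbhs_infty_ge.
have tailG M P : \sum_(M <= k < P) G k <= K * g ^+ M / (1 - g).
  apply: le_trans (geometric_tail_le M P K0 g01).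
  by apply: ler_sum => k _; case/andP: (GK k).
have ndG : nondecreasing_seq (series G).
  apply/nondecreasing_seqP => n; rewrite seriesSr lerDl.
  by case/andP: (GK n).
have cvG : cvgn (series G).
  apply: nondecreasing_is_cvgn => //; exists (K * g ^+ 0 / (1 - g)) => _ [n _ <-].
  exact: tailG.
set S := limn (series G).
have GS M : series G M <= S <= series G M + K * g ^+ M / (1 - g).
  rewrite nondecreasing_cvgn_le //=; apply: limr_le => //; near=> P.
  have MP : (M <= P)%N by near: P; exact: nbhs_infty_ge.
  by rewrite /series /= (big_cat_nat (leq0n M) MP) //= lerD2l.
exists S; last first.
  by apply: le_trans (proj1 (andP (GS 1%N))); rewrite /series /= big_nat1.
apply/cvgrPdist_le => e e0.
(* From the index M on, the limit series and all the sums are within e / 2. *)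
have [M MK] : exists M, K * g ^+ M / (1 - g) <= e / 2.
  have : K * g ^+ M / (1 - g) @[M --> \oo] --> K * 0 / (1 - g).
    by apply: cvgMr_tmp; apply: cvgMl_tmp; apply: cvg_expr; rewrite ger0_norm.
  rewrite mulr0 mul0r => /cvgr_le /(_ (e / 2)).
  by move=> /(_ ltac:(lra)) [M _ /(_ M (leqnn M)) H]; exists M.
have cvM : \sum_(0 <= k < M) F N k @[N --> \oo] --> series G M.
  exact: cvg_sum_seq.
near=> N.
have MN : (M <= N.+1)%N by apply: leqW; near: N; exact: nbhs_infty_ge.
have hM : `|series G M - \sum_(0 <= k < M) F N k| <= e / 2.
  by near: N; move/cvgrPdist_le: cvM; apply; lra.
rewrite (big_cat_nat (leq0n M) MN) //=.
have t0 : 0 <= \sum_(M <= k < N.+1) F N k.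
  rewrite big_nat_cond sumr_ge0 // => k /andP[/andP[_ kN] _].
  by case/andP: (FK N k kN).
have t1 : \sum_(M <= k < N.+1) F N k <= K * g ^+ M / (1 - g).
  apply: le_trans (geometric_tail_le M N.+1 K0 g01).
  rewrite [leLHS]big_nat_cond [leRHS]big_nat_cond.
  by apply: ler_sum => k /andP[/andP[_ kN] _]; case/andP: (FK N k kN).
move: (GS M) (hM) (t0) (t1) (MK); rewrite !ler_distl => /andP[].
set a := series G M; set b := \sum_(0 <= k < M) _; set t := \sum_(M <= k < _) _.
set u := _ / (1 - g) => h1 h2 /andP[h3 h4] h5 h6 h7.
by apply/andP; split; lra.
Unshelve. all: by end_near. Qed.

Lemma cvg_linear_ratio (R : realType) (a b c d : R) : c != 0 ->
  (a * N%:R + b) / (c * N%:R + d) @[N --> \oo] --> a / c.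
Proof.
move=> c0.
have H x y : x + y * (N.+1%:R : R)^-1 @[N --> \oo] --> x.
  rewrite -[X in _ --> X]addr0 -[X in _ --> _ + X](mulr0 y).
  apply: cvgD; first exact: cvg_cst.
  by apply: cvgMl_tmp; exact: cvg_harmonic.
rewrite -(cvg_shiftn 1) /=.
rewrite (_ : (fun _ => _)
  = (fun N => (a + b * (N.+1%:R : R)^-1) / (c + d * (N.+1%:R : R)^-1))).
  by apply: cvgM; [exact: H|apply: cvgV => //; exact: H].
apply/funext => N; rewrite addn1.
have N0 : N.+1%:R != 0 :> R by rewrite pnatr_eq0.
have -> : a * N.+1%:R + b = (a + b / N.+1%:R) * N.+1%:R by field.
have -> : c * N.+1%:R + d = (c + d / N.+1%:R) * N.+1%:R by field.
by rewrite invfM mulrACA mulfV // mulr1.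
Qed.

Lemma cvg_near_eq (R : realType) (f g : nat -> R) (l : R) :
  (\forall N \near \oo, f N = g N) -> g @ \oo --> l -> f @ \oo --> l.
Proof.
by move=> fg; apply: cvg_trans; apply: near_eq_cvg; near do apply/esym.
Unshelve. all: by end_near. Qed.

(** * Binomial coefficients near one third *)

(** 'C(3 N, N)^2 divided by its exponential growth: 'C(3 N, N) grows like
    (27 / 4)^N, and 729 / 16 is the square of 27 / 4. *)
Definition thirds_sq (R : realType) (N : nat) : R :=
  'C(3 * N, N)%:R ^+ 2 * (16 / 729) ^+ N.

Lemma thirds_sq_gt0 (R : realType) N : 0 < thirds_sq R N.
Proof.
apply: mulr_gt0; apply: exprn_gt0; first by rewrite ltr0n bin_gt0; lia.
by apply: divr_gt0; rewrite ltr0n.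
Qed.

Lemma thirds_sqS (R : realType) N :
  thirds_sq R N.+1 * (9 * (N%:R + 1) * (2 * N%:R + 1)) ^+ 2
    = thirds_sq R N * (2 * (3 * N%:R + 1) * (3 * N%:R + 2)) ^+ 2.
Proof.
have E : ('C(3 * N.+1, N.+1) * ((2 * N + 1) * (2 * N + 2) * (N + 1))
    = 'C(3 * N, N) * ((3 * N + 1) * (3 * N + 2) * (3 * N + 3)))%N.
  have h1 : (N <= 3 * N)%N by lia.
  have h2 : (N.+1 <= 3 * N.+1)%N by lia.
  have f0 : (0 < N`! * (2 * N)`!)%N by rewrite muln_gt0 !fact_gt0.
  apply/eqP; rewrite -(eqn_pmul2r f0); apply/eqP.
  have e1 := bin_fact h1; have := bin_fact h2.
  rewrite (_ : 3 * N.+1 - N.+1 = (2 * N).+2)%N; last lia.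
  rewrite (_ : 3 * N.+1 = (3 * N).+3)%N; last lia.
  rewrite (_ : 3 * N - N = 2 * N)%N in e1; last lia.
  rewrite !factS -e1.
  move: 'C(_, N.+1) 'C(_, N) (N`!) ((2 * N)`!) => c' c f g e.
  transitivity (c' * (N.+1 * f * ((2 * N).+2 * ((2 * N).+1 * g))))%N.
    by ring.
  by rewrite e; ring.
rewrite /thirds_sq [_ ^+ N.+1]exprS; move: 'C(3 * N.+1, N.+1) 'C(3 * N, N) E => c' c E.
have ER : c'%:R * ((2 * N%:R + 1) * 2 * (N%:R + 1))
    = c%:R * ((3 * N%:R + 1) * (3 * N%:R + 2) * 3) :> R.
  have N1 : N%:R + 1 != 0 :> R by rewrite natr1 pnatr_eq0.
  apply: (mulIf N1).
  transitivity ((c' * ((2 * N + 1) * (2 * N + 2) * (N + 1)))%N%:R : R).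
    by ring.
  by rewrite E; ring.
move: ER; move: (c'%:R : R) (c%:R : R) => u v ER.
transitivity ((16 / 729) ^+ N * 4 / 9 * (u * ((2 * N%:R + 1) * 2 * (N%:R + 1))) ^+ 2).
  by field.
by rewrite ER; field.
Qed.

(** The factor N + 1 in place of N makes the sequence nonincreasing: after
    clearing denominators, the difference of consecutive terms is a polynomial
    in N with positive coefficients. *)
Lemma thirds_sq_le (R : realType) N : N%:R * thirds_sq R N <= 1.
Proof.
have den n : 0 < (9 * (n%:R + 1) * (2 * n%:R + 1)) ^+ 2 :> R.
  by rewrite exprn_gt0 // !mulr_gt0 // ltr_wpDl // mulr_ge0.
suff : (N%:R + 1) * thirds_sq R N <= 1 by have := thirds_sq_gt0 R N; lra.
elim: N => [|N]; first by rewrite /thirds_sq bin0 !expr0 expr1n !mulr1 add0r.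
apply: le_trans; rewrite -(ler_pM2r (den N)) -[leLHS]mulrA thirds_sqS -[N.+1%:R]natr1.
have := thirds_sq_gt0 R N; move: (thirds_sq R N) (N%:R : R) (ler0n R N) => b x x0 b0.
rewrite mulrCA [leRHS]mulrAC [leRHS]mulrC ler_pM2l //.
rewrite -subr_ge0.
have -> : (x + 1) * (9 * (x + 1) * (2 * x + 1)) ^+ 2 -
    (x + 1 + 1) * (2 * (3 * x + 1) * (3 * x + 2)) ^+ 2
  = 261 * x ^+ 3 + 459 * x ^+ 2 + 263 * x + 49 by ring.
have := exprn_ge0 2 x0; have := exprn_ge0 3 x0.
by move: (x ^+ 2) (x ^+ 3) => x2 x3; lra.
Qed.

(** The sequence is nondecreasing, so its first positive term bounds the limit
    from below; this replaces Stirling's formula. *)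
Lemma cvg_thirds_sq (R : realType) :
  exists2 L : R, 0 < L & N%:R * thirds_sq R N @[N --> \oo] --> L.
Proof.
have den N : 0 < (9 * (N%:R + 1) * (2 * N%:R + 1)) ^+ 2 :> R.
  by rewrite exprn_gt0 // !mulr_gt0 // ltr_wpDl // mulr_ge0.
have nd : nondecreasing_seq (fun N => N%:R * thirds_sq R N).
  apply/nondecreasing_seqP => N.
  rewrite -(ler_pM2r (den N)) -[leRHS]mulrA thirds_sqS -[N.+1%:R]natr1.
  have := thirds_sq_gt0 R N; move: (thirds_sq R N) (N%:R : R) (ler0n R N) => b x x0 b0.
  rewrite -subr_ge0.
  have -> : (x + 1) * (b * (2 * (3 * x + 1) * (3 * x + 2)) ^+ 2)
      - x * b * (9 * (x + 1) * (2 * x + 1)) ^+ 2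
    = b * ((x + 1) * (63 * x ^+ 2 + 63 * x + 16)) by ring.
  apply: mulr_ge0; first exact: ltW.
  apply: mulr_ge0; first by lra.
  by have := exprn_ge0 2 x0; move: (x ^+ 2) => x2; lra.
have cv : cvgn (fun N => N%:R * thirds_sq R N).
  by apply: nondecreasing_is_cvgn => //; exists 1 => _ [N _ <-]; exact: thirds_sq_le.
exists (limn (fun N => N%:R * thirds_sq R N)) => //.
apply: lt_le_trans (nondecreasing_cvgn_le nd cv 1).
by rewrite mul1r thirds_sq_gt0.
Qed.

Lemma cvg_mul_seq (R : realType) (u v : nat -> R) (a b : R) :
  u @ \oo --> a -> v @ \oo --> b -> u N * v N @[N --> \oo] --> a * b.
Proof. by move=> ua vb; apply: cvgM. Qed.

(** Increasing r or k by one multiplies the quotient by a ratio of linear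
    functions of N, which tends to 3 / 2 or to 1 / 2. *)
Lemma cvg_bin_third_ratio (R : realType) r k :
  exists2 l : R, 0 < l &
    'C(3 * N + r, N - k)%:R / 'C(3 * N, N)%:R @[N --> \oo] --> l.
Proof.
have two0 : 2 != 0 :> R by rewrite pnatr_eq0.
elim: k => [|k [l l0 IH]]; last first.
  exists (l * (1 / 2)); first by apply: mulr_gt0 => //; lra.
  have H := cvg_mul_seq IH (@cvg_linear_ratio R 1 (- k%:R) 2 (r + k.+1)%:R two0).
  apply: (cvg_near_eq _ H); near=> N.
  have kN : (k.+1 <= N)%N by near: N; exact: nbhs_infty_ge.
  have := mul_bin_left (3 * N + r) (N - k.+1).
  rewrite (_ : (N - k.+1).+1 = N - k)%N; last lia.
  rewrite (_ : 3 * N + r - (N - k.+1) = 2 * N + (r + k.+1))%N; last lia.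
  move=> /(congr1 (fun n : nat => n%:R : R)).
  rewrite !natrM natrB; last lia.
  rewrite [(2 * N + _)%:R]natrD natrM mul1r.
  have : 2 * N%:R + (r + k.+1)%:R != 0 :> R.
    by rewrite -natrM -natrD pnatr_eq0 !addnS.
  have : 'C(3 * N, N)%:R != 0 :> R by rewrite pnatr_eq0 -lt0n bin_gt0; lia.
  move: (2 * N%:R + (r + k.+1)%:R) (N%:R - k%:R) => e f.
  move: ('C(_, N - k)%:R : R) ('C(_, N - k.+1)%:R : R) ('C(_, N)%:R : R) => u v w.
  move=> w0 e0 E; apply: (mulIf e0).
  by rewrite /= mulrAC -[v * _]mulrC -E; field; rewrite w0 e0.
elim: r => [|r [l l0 IH]].
  exists 1 => //; apply: (cvg_near_eq _ (cvg_cst (1 : R))); near=> N.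
  by rewrite addn0 subn0 divff // pnatr_eq0 -lt0n bin_gt0; lia.
exists (l * (3 / 2)); first by apply: mulr_gt0 => //; lra.
have H := cvg_mul_seq IH (@cvg_linear_ratio R 3 r.+1%:R 2 r.+1%:R two0).
apply: (cvg_near_eq _ H); near=> N; rewrite /= subn0.
have := mul_bin_down (3 * N + r.+1) N.
rewrite addnS /= (_ : (3 * N + r).+1 - N = 2 * N + r.+1)%N; last lia.
move=> /(congr1 (fun n : nat => n%:R : R)).
rewrite natrM [RHS]natrM -addnS [(3 * N + r.+1)%:R]natrD.
rewrite [(2 * N + r.+1)%:R]natrD [(3 * N)%:R]natrM [(2 * N)%:R]natrM.
have : 2 * N%:R + r.+1%:R != 0 :> R by rewrite -natrM -natrD pnatr_eq0 addnS.
have : 'C(3 * N, N)%:R != 0 :> R by rewrite pnatr_eq0 -lt0n bin_gt0; lia.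
move: (2 * N%:R + r.+1%:R) (3 * N%:R + r.+1%:R : R) => e f.
move: ('C(_ + _, N)%:R : R) ('C(_ + _, N)%:R : R) ('C(_, N)%:R : R) => u v w.
move=> w0 e0 E; apply: (mulIf e0).
by rewrite mulrAC [u * e]mulrC -E; field; rewrite w0 e0.
Unshelve. all: by end_near. Qed.

(** For l <= n / 3 the ratio of 'C(n, l) to 'C(n, l - 1) is (n - l + 1) / l,
    which is at least 2. *)
Lemma bin_third_le N r k : (k <= N)%N ->
  ('C(3 * N + r, N - k) * 2 ^ k <= 'C(3 * N + r, N))%N.
Proof.
elim: k => [|k IH] kN; first by rewrite subn0 muln1.
apply: leq_trans (IH (ltnW kN)).
rewrite expnS mulnA leq_mul2r expn_eq0 /=.
have := mul_bin_left (3 * N + r) (N - k.+1).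
rewrite (_ : (N - k.+1).+1 = N - k)%N; last lia.
rewrite (_ : 3 * N + r - (N - k.+1) = 2 * N + (r + k.+1))%N; last lia.
move: 'C(_, N - k) 'C(_, N - k.+1) => u v E.
have Nk : (0 < N - k)%N by lia.
rewrite -(leq_pmul2l Nk) E [leqLHS]mulnC -mulnA mulnC leq_mul2r; apply/orP; right.
lia.
Qed.

Lemma bin_third_shift_le N r : ('C(3 * N + r, N) <= 2 ^ r * 'C(3 * N, N))%N.
Proof.
elim: r => [|r IH]; first by rewrite addn0 mul1n.
rewrite expnS -mulnA; apply: leq_trans (leq_mul (leqnn 2) IH).
have := mul_bin_down (3 * N + r.+1) N.
rewrite addnS /= (_ : (3 * N + r).+1 - N = 2 * N + r.+1)%N; last lia.
move: 'C(_, N) 'C(_, N) => u v E.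
have p : (0 < 2 * N + r.+1)%N by rewrite addnS.
rewrite -(leq_pmul2l p) -E mulnA leq_mul2r; apply/orP; right; lia.
Qed.

Lemma bin_third_ratio_le (R : realType) N r k : (k <= N)%N ->
  'C(3 * N + r, N - k)%:R / 'C(3 * N, N)%:R <= 2 ^+ r * (1 / 2) ^+ k :> R.
Proof.
move=> kN.
have C0 : 0 < 'C(3 * N, N)%:R :> R by rewrite ltr0n bin_gt0; lia.
rewrite ler_pdivrMr // -(ler_pM2r (exprn_gt0 k (ltr0n _ 2))).
have halves : (1 / 2) ^+ k * 2 ^+ k = 1 :> R.
  by rewrite -exprMn divfK ?expr1n // pnatr_eq0.
rewrite [leRHS](_ : _ = 2 ^+ r * 'C(3 * N, N)%:R * ((1 / 2) ^+ k * 2 ^+ k)).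
  rewrite halves mulr1 -!natrX -!natrM ler_nat.
  exact: leq_trans (bin_third_le _ kN) (bin_third_shift_le _ _).
by ring.
Qed.

(** * Asymptotics for one endpoint and for the sum over all endpoints *)

Lemma quadrant_walks_model (i j n m : nat) : n = (i + 3 * j + 3 * m)%N ->
  (quadrant_walks model i j n)%:R = walk_formula n i j m.
Proof. by move=> nE; apply: walk_countE; lia. Qed.

(** The sums m + (2 m + i + 3 j) and (m + j) + (2 m + i + 2 j) both equal n, so
    the four factorials of the denominator pair up into two binomial
    coefficients of n. *)
Lemma quadrant_walks_bin (R : realType) (i j n m : nat) :
  n = (i + 3 * j + 3 * m)%N ->
  (quadrant_walks model i j n)%:R = 'C(n, m)%:R * 'C(n, m + j)%:R
    * ((i + 1) * (j + 1) * (i + 3 * j + 4))%:R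
    * (((i + 2 * j + 2) * (i + 2 * j + 3) + m * (2 * i + 3 * j + 4))%:R
       / (m + j + 1)%:R)
    * (n + 1)%:R * (n + 2)%:R * (n + 3)%:R
    / ((2 * m + i + 2 * j + 1)%:R * (2 * m + i + 2 * j + 2)%:R
       * (2 * m + i + 2 * j + 3)%:R * (2 * m + i + 3 * j + 1)%:R
       * (2 * m + i + 3 * j + 2)%:R * (2 * m + i + 3 * j + 3)%:R
       * (2 * m + i + 3 * j + 4)%:R) :> R.
Proof.
move=> nE; have := quadrant_walks_model nE; rewrite walk_formula_nat.
set q := quadrant_walks _ _ _ _; set P := ((i + 2 * j + 2) * _ + _)%N.
set A := ((i + 1) * (j + 1) * _)%N.
have h1 : (m <= n)%N by lia.
have h2 : (m + j <= n)%N by lia.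
have := bin_fact h1; have := bin_fact h2.
rewrite (_ : n - m = 2 * m + i + 3 * j)%N; last lia.
rewrite (_ : n - (m + j) = 2 * m + i + 2 * j)%N; last lia.
set b := 'C(n, m); set b' := 'C(n, m + j).
move=> e2 e1.
have fN0 k : k`!%:R != 0 :> R by rewrite pnatr_eq0 -lt0n fact_gt0.
move=> qE.
set D := (m`! * _ * _ * _)%N in qE.
have D0 : (0 < D)%N by rewrite !muln_gt0 !fact_gt0.
have {}qE : (q * D = A * P * n`! * (n + 3)`!)%N.
  apply/eqP; rewrite -(eqr_nat rat) [(q * D)%:R]natrM qE divfK //.
  by rewrite pnatr_eq0 -lt0n.
have DR : D%:R != 0 :> R by rewrite pnatr_eq0 -lt0n.
apply: (mulIf DR); rewrite -[LHS]natrM qE {DR D0 qE}/D.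
rewrite addn3 addn4 !addn1 !addn2 !addn3 !factS -{1}e1 -e2.
move: (fN0 m) (fN0 (m + j)%N) (fN0 (2 * m + i + 2 * j)%N) (fN0 (2 * m + i + 3 * j)%N).
move: (2 * m + i + 2 * j)%N (2 * m + i + 3 * j)%N (m + j)%N => c d l.
rewrite !natrM.
move: (m`!%:R : R) (l`!%:R : R) (c`!%:R : R) (d`!%:R : R) => fm fl fc fd m0 l0 c0 d0.
have S0 k : k.+1%:R != 0 :> R by rewrite pnatr_eq0.
have := (S0 l, S0 c, S0 c.+1, S0 c.+2, S0 d, S0 d.+1, S0 d.+2, S0 d.+3).
move: (l.+1%:R : R) (c.+1%:R : R) (c.+2%:R : R) (c.+3%:R : R) => l1 c1 c2 c3.
move: (d.+1%:R : R) (d.+2%:R : R) (d.+3%:R : R) (d.+4%:R : R) => d1 d2 d3 d4.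
move: (n.+1%:R : R) (n.+2%:R : R) (n.+3%:R : R) => n1 n2 n3.
move=> [[[[[[[h11 h12] h13] h14] h15] h16] h17] h18].
field.
by rewrite h11 h12 h13 h14 h15 h16 h17 h18.
Qed.

(** The endpoints of walks with n = 3 N + r steps, r < 3, are the points (i, j)
    with i = r + 3 (k - j) and j <= k <= N; then m = N - k. The count is divided
    by its expected order (729 / 16)^N / N^5. *)
Definition walk_term (R : realType) (r k j N : nat) : R :=
  (quadrant_walks model (r + 3 * (k - j)) j (3 * N + r))%:R
  * N%:R ^+ 5 * (16 / 729) ^+ N.

(** The polynomial factor of the formula is weight * (weight0 + m * weight1). *)
Definition weight (i j : nat) : nat := (i + 1) * (j + 1) * (i + 3 * j + 4).
Definition weight0 (i j : nat) : nat := (i + 2 * j + 2) * (i + 2 * j + 3).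
Definition weight1 (i j : nat) : nat := 2 * i + 3 * j + 4.

(** One factor N of N^5 goes to [thirds_sq] and one to each of the last four
    denominators; every factor then converges and is bounded on its own. *)
Lemma walk_termE (R : realType) (r k j N : nat) : (j <= k <= N)%N ->
  walk_term R r k j N =
    let i := (r + 3 * (k - j))%N in
    'C(3 * N + r, N - k)%:R / 'C(3 * N, N)%:R
    * ('C(3 * N + r, N - (k - j))%:R / 'C(3 * N, N)%:R)
    * (N%:R * thirds_sq R N) * (weight i j)%:R
    * (((weight0 i j)%:R + (N - k)%:R * (weight1 i j)%:R) / (N - k + j + 1)%:R)
    * ((3 * N + r + 1)%:R / (2 * N + r + (k - j) + 1)%:R)
    * ((3 * N + r + 2)%:R / (2 * N + r + (k - j) + 2)%:R)
    * ((3 * N + r + 3)%:R / (2 * N + r + (k - j) + 3)%:R)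
    * (N%:R / (2 * N + r + k + 1)%:R)
    * (N%:R / (2 * N + r + k + 2)%:R)
    * (N%:R / (2 * N + r + k + 3)%:R)
    * (N%:R / (2 * N + r + k + 4)%:R).
Proof.
move=> /andP[jk kN]; cbv zeta; set i := (r + 3 * (k - j))%N.
rewrite /walk_term -/i.
have nE : (3 * N + r = i + 3 * j + 3 * (N - k))%N by rewrite /i; lia.
rewrite (quadrant_walks_bin R nE) -/(weight i j) -/(weight0 i j) -/(weight1 i j).
have -> : (N - k + j = N - (k - j))%N by lia.
have -> : (2 * (N - k) + i + 2 * j = 2 * N + r + (k - j))%N by rewrite /i; lia.
have -> : (2 * (N - k) + i + 3 * j = 2 * N + r + k)%N by rewrite /i; lia.
rewrite [(weight0 i j + _)%:R]natrD natrM /thirds_sq.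
have : 'C(3 * N, N)%:R != 0 :> R by rewrite pnatr_eq0 -lt0n bin_gt0; lia.
have S0 l p : (l + p.+1)%:R != 0 :> R by rewrite pnatr_eq0 addnS.
move: (S0 (N - (k - j))%N 0%N) (S0 (2 * N + r + (k - j))%N 0%N)
  (S0 (2 * N + r + (k - j))%N 1%N) (S0 (2 * N + r + (k - j))%N 2%N)
  (S0 (2 * N + r + k)%N 0%N) (S0 (2 * N + r + k)%N 1%N)
  (S0 (2 * N + r + k)%N 2%N) (S0 (2 * N + r + k)%N 3%N).
move: ((N - (k - j) + 1)%:R : R) ((2 * N + r + (k - j) + 1)%:R : R)
  ((2 * N + r + (k - j) + 2)%:R : R) ((2 * N + r + (k - j) + 3)%:R : R)
  ((2 * N + r + k + 1)%:R : R) ((2 * N + r + k + 2)%:R : R)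
  ((2 * N + r + k + 3)%:R : R) ((2 * N + r + k + 4)%:R : R).
move=> l1 c1 c2 c3 d1 d2 d3 d4 h1 h2 h3 h4 h5 h6 h7 h8 h9.
move: ((16 / 729) ^+ N : R) ('C(3 * N, N)%:R : R) h9 => g u u0.
move: ('C(_, N - k)%:R : R) ('C(_, N - (k - j))%:R : R) => b b'.
move: ((3 * N + r + 1)%:R : R) ((3 * N + r + 2)%:R : R) ((3 * N + r + 3)%:R : R).
move: ((weight i j)%:R : R) ((weight0 i j)%:R : R) ((weight1 i j)%:R : R).
move: (N%:R : R) ((N - k)%:R : R) => x y w w0 w1 n1 n2 n3.
field.
by rewrite u0 h1 h2 h3 h4 h5 h6 h7 h8.
Qed.

Lemma cvg_walk_term (R : realType) (r k j : nat) : (j <= k)%N ->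
  exists2 l : R, 0 < l & walk_term R r k j N @[N --> \oo] --> l.
Proof.
move=> jk.
have [L L0 HL] := cvg_thirds_sq R.
have [l1 l10 H1] := cvg_bin_third_ratio R r k.
have [l2 l20 H2] := cvg_bin_third_ratio R r (k - j).
set i := (r + 3 * (k - j))%N.
set w1 : R := (weight1 i j)%:R.
have lin (a b c d : R) : 0 < a -> 0 < c -> 0 < a / c /\
    (a * N%:R + b) / (c * N%:R + d) @[N --> \oo] --> a / c.
  move=> a0 c0; split; first exact: divr_gt0.
  by apply: cvg_linear_ratio; rewrite gt_eqF.
have t3 : 0 < 3 :> R by lra.
have t2 : 0 < 2 :> R by lra.
have w10 : 0 < w1 by rewrite ltr0n /weight1 addn_gt0 orbT.
have [q0 HE] := lin w1 ((weight0 i j)%:R - k%:R * w1) 1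
  (1 + j%:R - k%:R) w10 ltr01.
have [e1 E1] := lin 3 (r + 1)%:R 2 (r + (k - j) + 1)%:R t3 t2.
have [e2 E2] := lin 3 (r + 2)%:R 2 (r + (k - j) + 2)%:R t3 t2.
have [e3 E3] := lin 3 (r + 3)%:R 2 (r + (k - j) + 3)%:R t3 t2.
have [f1 F1] := lin 1 0 2 (r + k + 1)%:R ltr01 t2.
have [f2 F2] := lin 1 0 2 (r + k + 2)%:R ltr01 t2.
have [f3 F3] := lin 1 0 2 (r + k + 3)%:R ltr01 t2.
have [f4 F4] := lin 1 0 2 (r + k + 4)%:R ltr01 t2.
have W0 : 0 < (weight i j)%:R :> R.
  by rewrite ltr0n /weight !muln_gt0 !addn_gt0 /= !orbT.
have HW : (fun _ : nat => (weight i j)%:R : R) @ \oo --> ((weight i j)%:R : R).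
  exact: cvg_cst.
have H := cvg_mul_seq (cvg_mul_seq (cvg_mul_seq (cvg_mul_seq (cvg_mul_seq
  (cvg_mul_seq (cvg_mul_seq (cvg_mul_seq (cvg_mul_seq (cvg_mul_seq (cvg_mul_seq
  H1 H2) HL) HW) HE) E1) E2) E3) F1) F2) F3) F4.
eexists; last first.
  apply: (cvg_near_eq _ H); near=> N.
  have kN : (k <= N)%N by near: N; exact: nbhs_infty_ge.
  rewrite walk_termE ?jk //= -/i -/w1.
  have X (a b : nat) (c : nat) : (a * N + b + c)%:R = a%:R * N%:R + (b + c)%:R :> R.
    by ring.
  have Y (b c d : nat) : (2 * N + b + c + d)%:R = 2 * N%:R + (b + c + d)%:R :> R.
    by ring.
  rewrite !X !Y !addr0 !mul1r.
  rewrite (_ : (weight0 i j)%:R + _ = w1 * N%:R + ((weight0 i j)%:R - k%:R * w1)).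
    rewrite (_ : (N - k + j + 1)%:R = N%:R + (1 + j%:R - k%:R)) //.
    by rewrite !natrD natrB //; ring.
  by rewrite natrB //; ring.
by rewrite !mulr_gt0.
Unshelve. all: by end_near. Qed.

Lemma weight_le r k j : (r < 3)%N -> (j <= k)%N ->
  let i := (r + 3 * (k - j))%N in
  (weight i j * (weight0 i j + weight1 i j) <= 18 * 28 * k.+1 ^ 5)%N.
Proof.
move=> r3 jk; cbv zeta; set i := (r + 3 * (k - j))%N.
have -> : (18 * 28 * k.+1 ^ 5 = (3 * k.+1 * k.+1 * (6 * k.+1)) *
    ((4 * k.+1) * (5 * k.+1) + 8 * k.+1 * k.+1))%N by ring.
(* i + 1, j + 1, i + 3 j + 4, i + 2 j + 2, i + 2 j + 3 and [weight1] are at most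
   3, 1, 6, 4, 5 and 8 times k + 1. *)
apply: leq_mul; first by do !apply: leq_mul; rewrite /i; lia.
apply: leq_add; first by apply: leq_mul; rewrite /i; lia.
by rewrite -[weight1 _ _]muln1; apply: leq_mul; rewrite /weight1 /i; lia.
Qed.

Lemma mulr_bounds (R : realType) (x y a b : R) :
  0 <= x <= a -> 0 <= y <= b -> 0 <= x * y <= a * b.
Proof.
by move=> /andP[x0 xa] /andP[y0 yb]; rewrite mulr_ge0 ?ler_pM.
Qed.

(** The bound does not depend on N. The first binomial quotient supplies 2^-k,
    and the constant 2^7 comes from two binomial quotients (4 each) and three
    quotients of linear functions (2 each). *)
Lemma walk_term_le (R : realType) r k j N : (r < 3)%N -> (j <= k <= N)%N ->
  0 <= walk_term R r k j N
    <= 2 ^+ 7 * (18 * 28) * k.+1%:R ^+ 5 * (1 / 2) ^+ k.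
Proof.
move=> r3 jkN; have /andP[jk kN] := jkN.
apply/andP; split.
  apply: mulr_ge0; last by apply/exprn_ge0/divr_ge0; rewrite ler0n.
  by apply: mulr_ge0; [rewrite ler0n|apply/exprn_ge0; rewrite ler0n].
rewrite walk_termE //; cbv zeta; set i := (r + 3 * (k - j))%N.
set W : R := (weight i j)%:R; set V : R := (weight0 i j)%:R + (weight1 i j)%:R.
have q0 (a b : nat) : 0 <= a%:R / b%:R :> R by apply: divr_ge0; rewrite ler0n.
have half0 p : 0 <= (1 / 2) ^+ p :> R by apply: exprn_ge0; lra.
have half1 p : (1 / 2) ^+ p <= 1 :> R by apply: exprn_ile1; lra.
have two_r : 2 ^+ r <= 2 ^+ 2 :> R by rewrite ler_eXn2l //; lra.
have B1 : 'C(3 * N + r, N - k)%:R / 'C(3 * N, N)%:R <= 2 ^+ 2 * (1 / 2) ^+ k :> R.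
  by apply: le_trans (bin_third_ratio_le R r kN) _; apply: ler_wpM2r.
have B2 : 'C(3 * N + r, N - (k - j))%:R / 'C(3 * N, N)%:R <= 2 ^+ 2 :> R.
  have kjN : (k - j <= N)%N by lia.
  apply: le_trans (bin_third_ratio_le R r kjN) _.
  by rewrite -[leRHS]mulr1; apply: ler_pM; rewrite ?half0 ?half1.
have B3 := thirds_sq_le R N.
have B5 : ((weight0 i j)%:R + (N - k)%:R * (weight1 i j)%:R) / (N - k + j + 1)%:R <= V.
  rewrite ler_pdivrMr ?ltr0n ?addn1 // -natrM /V -!natrD -natrM ler_nat.
  by rewrite mulnDl; apply: leq_add; rewrite ?leq_pmulr // mulnC leq_mul2l; lia.
have le2 (a b : nat) : (0 < b)%N -> (a <= 2 * b)%N -> 0 <= (a%:R / b%:R : R) <= 2.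
  by move=> b0 ab; rewrite q0 ler_pdivrMr ?ltr0n // -natrM ler_nat.
have le1 (a b : nat) : (0 < b)%N -> (a <= b)%N -> 0 <= (a%:R / b%:R : R) <= 1.
  by move=> b0 ab; rewrite q0 ler_pdivrMr ?ltr0n // mul1r ler_nat.
have {}B1 := conj (q0 'C(3 * N + r, N - k) 'C(3 * N, N)) B1.
have {}B2 := conj (q0 'C(3 * N + r, N - (k - j)) 'C(3 * N, N)) B2.
have {}B3 : 0 <= N%:R * thirds_sq R N <= 1.
  by rewrite B3 andbT mulr_ge0 ?ler0n // ltW // thirds_sq_gt0.
have {}B5 : 0 <= (((weight0 i j)%:R + (N - k)%:R * (weight1 i j)%:R)
    / (N - k + j + 1)%:R : R) <= V.
  by rewrite B5 andbT -natrM -natrD q0.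
have B4 : 0 <= W <= W by rewrite lexx ler0n.
have C1 : 0 <= ((3 * N + r + 1)%:R / (2 * N + r + (k - j) + 1)%:R : R) <= 2.
  by apply: le2; clear; lia.
have C2 : 0 <= ((3 * N + r + 2)%:R / (2 * N + r + (k - j) + 2)%:R : R) <= 2.
  by apply: le2; clear; lia.
have C3 : 0 <= ((3 * N + r + 3)%:R / (2 * N + r + (k - j) + 3)%:R : R) <= 2.
  by apply: le2; clear; lia.
have D1 : 0 <= (N%:R / (2 * N + r + k + 1)%:R : R) <= 1 by apply: le1; clear; lia.
have D2 : 0 <= (N%:R / (2 * N + r + k + 2)%:R : R) <= 1 by apply: le1; clear; lia.
have D3 : 0 <= (N%:R / (2 * N + r + k + 3)%:R : R) <= 1 by apply: le1; clear; lia.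
have D4 : 0 <= (N%:R / (2 * N + r + k + 4)%:R : R) <= 1 by apply: le1; clear; lia.
have /andP[_ H] := mulr_bounds (mulr_bounds (mulr_bounds (mulr_bounds
  (mulr_bounds (mulr_bounds (mulr_bounds (mulr_bounds (mulr_bounds
  (mulr_bounds (mulr_bounds (introT andP B1) (introT andP B2)) B3) B4) B5)
  C1) C2) C3) D1) D2) D3) D4.
apply: le_trans H _.
have WV : W * V <= 18 * 28 * k.+1%:R ^+ 5.
  by rewrite /W /V -natrD -!natrM -natrX -natrM ler_nat; exact: weight_le.
rewrite !mulr1 (_ : _ * 2 * 2 * 2 = 2 ^+ 7 * (1 / 2) ^+ k * (W * V)); last by ring.
rewrite [leRHS](_ : _ = 2 ^+ 7 * (1 / 2) ^+ k * (18 * 28 * k.+1%:R ^+ 5)); last by ring.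
by apply: ler_wpM2l WV; apply: mulr_ge0 => //; apply: exprn_ge0.
Qed.

Lemma quadrant_walks_model_eq0 (i j n : nat) :
  ~ (exists m : nat, n = (i + 3 * j + 3 * m)%N) -> quadrant_walks model i j n = 0%N.
Proof.
move=> noM; have [ni|ni] := boolP (3 %| (n%:Z - i%:Z)%R)%Z; last first.
  exact: walk_count_mod3.
have nE : n%:Z = i%:Z + 3 * j%:Z + 3 * (((n%:Z - i%:Z)%R %/ 3)%Z - j%:Z) by lia.
move: (_ - j%:Z) nE => m nE.
case: m nE => m nE; first by case: noM; exists m; lia.
apply/eqP; rewrite -(eqr_nat rat); apply/eqP.
by rewrite (walk_countE _ _ nE) // /walk_formula rfact_neg // !(mul0r, mulr0).
Qed.

Lemma total_quadrant_walks_model (r N : nat) : (r < 3)%N ->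
  total_quadrant_walks model (3 * N + r)
    = (\sum_(0 <= k < N.+1) \sum_(j < k.+1)
         quadrant_walks model (r + 3 * (k - j)) j (3 * N + r))%N.
Proof.
move=> r3; pose s := [seq ((r + 3 * (k - j))%N, j) | k <- iota 0 N.+1, j <- iota 0 k.+1].
have us : uniq s.
  apply: allpairs_uniq_dep; [exact: iota_uniq|by move=> k _; exact: iota_uniq|].
  move=> [k j] [k' j'] /allpairsPdep[x [y [_ + ->]]] /allpairsPdep[x' [y' [_ + ->]]] /=.
  rewrite !mem_iota /= !add0n !ltnS => yx yx' [E yy]; move: yx; rewrite yy => yx.
  by congr existT; lia.
rewrite /total_quadrant_walks (fsbigE s) //; last first.
  move=> [i j] _ ijs /=; apply: quadrant_walks_model_eq0 => -[m nE].
  move/negP: ijs; apply; apply/allpairsPdep; exists (N - m)%N, j.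
  by split; rewrite ?mem_iota; [lia|lia|congr pair; lia].
rewrite big_mkcond big_allpairs_dep.
rewrite /index_iota subn0; apply: eq_bigr => k _.
rewrite -[iota 0 k.+1]/(index_iota 0 k.+1) big_mkord; apply: eq_bigr => j _.
by rewrite mem_set.
Qed.

(** Bernoulli's inequality with a base whose sixth power is still below 2, as
    the domination of (k + 1)^6 / 2^k by a geometric sequence requires. *)
Lemma succ_le_geometric (R : realType) (k : nat) :
  k.+1%:R <= 20 * (21 / 20) ^+ k :> R.
Proof.
elim: k => [|k IH]; first by rewrite expr0 mulr1; lra.
rewrite -[k.+2%:R]natr1 exprS.
have : 1 <= (21 / 20) ^+ k :> R by apply: exprn_ege1; lra.
lra.
Qed.

Lemma cvg_total (R : realType) (r : nat) : (r < 3)%N ->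
  exists2 S : R, 0 < S &
    (total_quadrant_walks model (3 * N + r))%:R * N%:R ^+ 5 * (16 / 729) ^+ N
      @[N --> \oo] --> S.
Proof.
move=> r3.
pose G (k : nat) : R := \sum_(j < k.+1) lim (walk_term R r k j @ \oo).
have cv k (j : 'I_k.+1) : walk_term R r k j N @[N --> \oo] --> lim (walk_term R r k j @ \oo).
  have [l _ Hl] := @cvg_walk_term R r k j (ltn_ord j).
  by apply: cvgP Hl.
pose F N k : R := \sum_(j < k.+1) walk_term R r k j N.
have FG k : F N k @[N --> \oo] --> G k by apply: cvg_sum_seq => j; exact: cv.
pose K : R := 2 ^+ 7 * (18 * 28) * 20 ^+ 6.
pose g : R := (21 / 20) ^+ 6 / 2.
have K0 : 0 <= K.
  by apply: mulr_ge0; [apply: mulr_ge0; [apply: exprn_ge0; lra|lra]|apply: exprn_ge0; lra].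
have g01 : 0 <= g < 1.
  apply/andP; split; first by apply: divr_ge0; [apply: exprn_ge0|]; lra.
  by rewrite /g; lra.
have FK N k : (k <= N)%N -> 0 <= F N k <= K * g ^+ k.
  move=> kN.
  have T (j : 'I_k.+1) := @walk_term_le R r k j N r3.
  have jk (j : 'I_k.+1) : (j <= k <= N)%N by rewrite kN andbT -ltnS.
  apply/andP; split; first by apply: sumr_ge0 => j _; case/andP: (T j (jk j)).
  apply: le_trans (_ : \sum_(j < k.+1) (2 ^+ 7 * (18 * 28) * k.+1%:R ^+ 5 * (1 / 2) ^+ k) <= _).
    by apply: ler_sum => j _; case/andP: (T j (jk j)).
  rewrite sumr_const card_ord -[leLHS]mulr_natr.
  have -> : 2 ^+ 7 * (18 * 28) * k.+1%:R ^+ 5 * (1 / 2) ^+ k * k.+1%:R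
     = 2 ^+ 7 * (18 * 28) * (1 / 2) ^+ k * k.+1%:R ^+ 6 :> R.
    by move: (k.+1%:R : R) ((1 / 2) ^+ k : R) => x y; ring.
  have -> : K * g ^+ k = 2 ^+ 7 * (18 * 28) * (1 / 2) ^+ k * (20 * (21 / 20) ^+ k) ^+ 6.
    have -> : g ^+ k = ((21 / 20) ^+ k) ^+ 6 * (1 / 2) ^+ k.
      by rewrite /g; move: (21 / 20 : R) => x; rewrite exprMn -!exprM mulnC div1r.
    by rewrite /K; move: ((21 / 20) ^+ k : R) ((1 / 2) ^+ k : R) => x y; ring.
  apply: ler_wpM2l.
    by apply: mulr_ge0; [apply: mulr_ge0; [apply: exprn_ge0|]|apply: exprn_ge0]; lra.
  apply: lerXn2r (succ_le_geometric R k); rewrite nnegrE ?ler0n //.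
have [S HS GS] := tannery K0 g01 FK FG.
exists S.
  apply: lt_le_trans GS; rewrite /G big_ord1.
  have [l l0 Hl] := @cvg_walk_term R r 0 0 (leqnn 0).
  by rewrite (cvg_lim _ Hl).
apply: cvg_near_eq HS; near=> N.
rewrite total_quadrant_walks_model // natr_sum !mulr_suml; apply: eq_bigr => k _.
by rewrite natr_sum !mulr_suml.
Unshelve. all: by end_near. Qed.

(** * The exponents *)

Lemma cvg_mod3 (R : realType) (u : nat -> R) (l : R) :
  (forall r, (r < 3)%N -> u (3 * N + r)%N @[N --> \oo] --> l) -> u @ \oo --> l.
Proof.
move=> H; apply/cvgrPdist_le => e e0.
have B r : (r < 3)%N -> exists M, forall N, (M <= N)%N -> `|l - u (3 * N + r)%N| <= e.
  by move=> /H /cvgrPdist_le /(_ e e0) [M _ HM]; exists M => N /HM.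
have [M0 H0] := B 0%N isT; have [M1 H1] := B 1%N isT; have [M2 H2] := B 2%N isT.
near=> n; rewrite (divn_eq n 3) mulnC.
have n3 : (maxn M0 (maxn M1 M2) <= n %/ 3)%N.
  rewrite leq_divRL //; near: n; exact: nbhs_infty_ge.
move: n3; rewrite !geq_max => /and3P[n0 n1 n2].
have : (n %% 3 < 3)%N by rewrite ltn_mod.
case: (n %% 3)%N => [|[|[|//]]] _; [exact: H0|exact: H1|exact: H2].
Unshelve. all: by end_near. Qed.

(** Every step adds 1 modulo 3 to the first coordinate, and the steps (1, 0),
    (1, 0), (-2, 0) form a closed walk. *)
Lemma period_model : is_period model 3.
Proof.
move=> d; split => [d3 n w w0|H].
  apply: dvdn_trans d3 _.
  have E (s : seq model) : (3 %| (position s).1 - (size s)%:Z)%Z.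
    elim: s => [|s w' IH]; first by rewrite /position big_nil.
    rewrite /position big_cons /= -/(position w').
    have : (3 %| (fsval s).1 - 1)%Z.
      have := fsvalP s; rewrite !inE.
      by move=> /orP[/orP[/orP[]|]|] /eqP->.
    move: IH; rewrite /=; lia.
  by have := E w; rewrite w0 size_tuple /=; lia.
have a : ((1, 0) : lattice_point) \in model by rewrite !inE eqxx.
have b : ((-2, 0) : lattice_point) \in model by rewrite !inE eqxx !orbT.
apply: (H 3 [tuple [` a]%fset; [` a]%fset; [` b]%fset]).
by rewrite /position /= !big_cons big_nil.
Qed.

Lemma powR_opp5 (R : realType) (n : nat) :
  n%:R `^ (- 5 : R) = (n%:R ^+ 5)^-1 :> R.
Proof. by rewrite powRN powR_mulrn // ler0n. Qed.

Lemma exists_cube_root (R : realType) (c : R) :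
  0 < c -> exists2 x : R, 0 < x & x ^+ 3 = c.
Proof.
move=> c0; exists (c `^ (3^-1)); first exact: powR_gt0.
rewrite -powR_mulrn ?powR_ge0 // -powRrM mulVf ?pnatr_eq0 //.
by rewrite powRr1 // ltW.
Qed.

Lemma excursion_exponent_model (R : realType) : is_excursion_exponent model (- 5 : R).
Proof.
exists 3; split; first exact: period_model.
have [l l0 Hl] := @cvg_walk_term R 0 0 0 (leqnn 0).
have c0 : 0 < 729 / 16 :> R by lra.
have [mu mu0 mu3] := exists_cube_root c0.
(* n = 3 N, so the limit l for N^5 becomes 3^5 l for n^5. *)
exists mu, (l / 2 * 3 ^+ 5), (l * 2 * 3 ^+ 5).
have p35 : 0 < 3 ^+ 5 :> R by apply: exprn_gt0.
split=> //; try by apply: mulr_gt0 => //; lra.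
have lo : l / 2 < l by lra.
have hi : l < l * 2 by lra.
have [M1 _ H1] := cvgr_ge _ Hl _ lo.
have [M2 _ H2] := cvgr_le _ Hl _ hi.
exists (3 * (maxn M1 (maxn M2 1)))%N => // n /= nM n3.
move/dvdnP: n3 nM => [N ->]; rewrite (mulnC N) leq_pmul2l // !geq_max.
move=> /and3P[N1 N2 N0]; rewrite powR_opp5.
have := H1 N N1; have := H2 N N2; rewrite /= /walk_term addn0 muln0 addn0.
rewrite exprM mu3.
have -> : (3 * N)%:R ^+ 5 = 3 ^+ 5 * N%:R ^+ 5 :> R by rewrite natrM exprMn.
set q := (quadrant_walks _ _ _ _)%:R.
have N5 : 0 < N%:R ^+ 5 :> R by rewrite exprn_gt0 // ltr0n.
have -> : (16 / 729) ^+ N = ((729 / 16) ^+ N)^-1 :> R by rewrite -exprVn invf_div.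
have g0 : 0 < (729 / 16) ^+ N :> R by apply: exprn_gt0.
move: (N%:R ^+ 5 : R) ((729 / 16) ^+ N : R) (3 ^+ 5 : R) N5 g0 p35 => x g p x0 g0 p0.
rewrite ler_pdivrMr // ler_pdivlMr // => h2 h1.
have E (y : R) : y * p * g / (p * x) = y * g / x by field; rewrite !gt_eqF.
by rewrite !E ler_pdivrMr // ler_pdivlMr // h1 h2.
Qed.

Lemma walk_exponent_model (R : realType) : is_walk_exponent model (- 5 : R).
Proof.
have [S HS] : exists S : nat -> R, forall r, (r < 3)%N -> 0 < S r /\
    (total_quadrant_walks model (3 * N + r))%:R * N%:R ^+ 5 * (16 / 729) ^+ N
      @[N --> \oo] --> S r.
  have [S0 p0 H0] := @cvg_total R 0 isT; have [S1 p1 H1] := @cvg_total R 1 isT.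
  have [S2 p2 H2] := @cvg_total R 2 isT.
  by exists (nth 1 [:: S0; S1; S2]) => -[|[|[|//]]].
have c0 : 0 < 729 / 16 :> R by lra.
have [rho rho0 rho3] := exists_cube_root c0.
have p35 : 0 < 3 ^+ 5 :> R by apply: exprn_gt0.
(* For n = 3 N + r the limit S r is relative to N^5 and rho^(3 N); the other two
   factors convert it to n^5 and rho^n. *)
pose C n := S (n %% 3)%N * 3 ^+ 5 / rho ^+ (n %% 3).
have C0 n : 0 < C n.
  apply: divr_gt0; last exact: exprn_gt0.
  by apply: mulr_gt0 => //; apply: (proj1 (HS _ _)); rewrite ltn_mod.
exists rho, C; split => //; first by exists 3 => // n; rewrite /C modnDr.
pose g n : R := C n * rho ^+ n * n%:R `^ (- 5).
have g0 n : 0 <= g n.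
  by apply: mulr_ge0; [apply: mulr_ge0; [exact: ltW|apply: exprn_ge0; exact: ltW]|exact: powR_ge0].
have H : (total_quadrant_walks model n)%:R / g n @[n --> \oo] --> (1 : R).
  apply: cvg_mod3 => r r3; have [Sr0 Hr] := HS r r3.
  have t3 : 3 != 0 :> R by rewrite pnatr_eq0.
  have L := @cvg_linear_ratio R 3 r%:R 3 0 t3; rewrite divff // in L.
  have L2 := cvg_mul_seq L L; have L4 := cvg_mul_seq L2 L2.
  have cst : (fun _ : nat => (S r)^-1) @ \oo --> (S r)^-1 by exact: cvg_cst.
  have K := cvg_mul_seq (cvg_mul_seq Hr cst) (cvg_mul_seq L4 L).
  rewrite [S r / S r]divff ?gt_eqF // !mulr1 in K.
  apply: (cvg_near_eq _ K); near=> N.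
  have N0 : 0 < N%:R :> R by rewrite ltr0n; near: N; exact: nbhs_infty_gt.
  have n0 : 0 < 3 * N%:R + r%:R :> R by rewrite ltr_wpDr ?ler0n // mulr_gt0.
  rewrite /g powR_opp5 /C.
  have -> : ((3 * N + r) %% 3 = r)%N by rewrite mulnC modnMDl modn_small.
  rewrite exprD exprM rho3 natrD natrM.
  have -> : (16 / 729) ^+ N = ((729 / 16) ^+ N)^-1 :> R by rewrite -exprVn invf_div.
  have e0 : (729 / 16) ^+ N != 0 :> R by apply: expf_neq0; rewrite gt_eqF.
  have f0 : rho ^+ r != 0 by apply: expf_neq0; rewrite gt_eqF.
  move: (gt_eqF n0) (gt_eqF N0) (gt_eqF Sr0) => n1 N1 S1.
  move: ((729 / 16) ^+ N : R) (rho ^+ r) e0 f0 => e f e0 f0.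
  move: (3 * N%:R + r%:R) n1 => n n1.
  move: (N%:R : R) (S r) N1 S1 => x s x1 s1.
  by field; rewrite n1 x1 s1 e0 f0.
apply/eqaddoP => eps eps0.
move/cvgrPdist_le: H => /(_ eps eps0).
apply: filterS2 (nbhs_infty_gt 0) => n n0 /= H.
rewrite -/(g n) (ger0_norm (g0 n)).
have gn : g n != 0.
  rewrite /g powR_opp5 mulf_neq0 ?invr_neq0 ?expf_neq0 ?gt_eqF ?ltr0n //.
  by apply: mulr_gt0 => //; apply: exprn_gt0.
have gp : 0 < g n by rewrite lt_def gn g0.
rewrite -ler_pdivrMr // -[X in _ / X](ger0_norm (g0 n)) -normf_div.
by rewrite mulrDl mulNr divff // distrC.
Unshelve. all: by end_near. Qed.

Theorem proposition26 (R : realType) :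
  [/\ quadrant_gf model = nonneg_part model_series,
      forall i j n : nat,
        ~ (exists m : nat, n = (i + 3 * j + 3 * m)%N) ->
        quadrant_walks model i j n = 0%N,
      forall i j n m : nat, n = (i + 3 * j + 3 * m)%N ->
        (quadrant_walks model i j n)%:R =
          ((i + 1) * (j + 1) * (i + 3 * j + 4)
            * ((i + 2 * j + 2) * (i + 2 * j + 3) + m * (2 * i + 3 * j + 4))
            * n`! * (n + 3)`!)%N%:R
          / (m`! * (m + j + 1)`! * (2 * m + i + 2 * j + 3)`!
            * (2 * m + i + 3 * j + 4)`!)%N%:R :> rat,
      is_excursion_exponent model (- 5 : R) &
      is_walk_exponent model (- 5 : R)].
Proof.
split.
- exact: quadrant_gf_model.
- exact: quadrant_walks_model_eq0.
- by move=> i j n m nE; rewrite (quadrant_walks_model nE) walk_formula_nat.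
- exact: excursion_exponent_model.
- exact: walk_exponent_model.
Qed.
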